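(* Let $\varepsilon>0$, $u_0\in\mathcal V_{[0,1]}\setminus\{\mathbf 0,\mathbf 1\}$, and $\tau_n\downarrow0$. For each $\tau\in(0,\varepsilon)$ let $(u^{[\tau]}_m)_{m\ge0}$, $(\beta^{[\tau]}_m)_{m\ge1}$ be any semi-discrete iterates with time step $\tau$ and initial state $u^{[\tau]}_0=u_0$. Then there exist a subsequence $\tau'_n$ of $\tau_n$ with $\tau'_n<\varepsilon$ for all $n$, and a solution $(\hat u,\gamma)$ of mass-conserving double-obstacle AC flow on $[0,\infty)$ with $\hat u(0)=u_0$, such that: (1) $t\mapsto\beta^{[\tau'_n]}_{\lceil t/\tau'_n\rceil}$ converges to $\gamma$ weakly in $L^2_{loc}([0,\infty);\mathcal V)$ and weakly-* in $L^\infty_{loc}([0,\infty);\mathcal V)$; (2) for each $t\ge0$, with $m:=\lceil t/\tau'_n\rceil$, $u^{[\tau'_n]}_m\to\hat u(t)$ as $n\to\infty$; (3) there is a sequence $N_k\to\infty$ such that for almost every $t\ge0$, with $m:=\lceil t/\tau'_n\rceil$, $\frac1{N_k}\sum_{n=1}^{N_k}\beta^{[\tau'_n]}_m\to\gamma(t)$ as $k\to\infty$.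
   Context: $G=(V,E)$ is a finite, simple, connected, undirected graph with weights $\omega_{ij}=\omega_{ji}>0$ for $ij\in E$, $\omega_{ij}=0$ otherwise; $d_i=\sum_j\omega_{ij}$, $r\in[0,1]$ fixed. $\mathcal V$ = functions $V\to\mathbb R$ with $\langle u,v\rangle_{\mathcal V}=\sum_i u_iv_id_i^r$; $\mathcal V_{[0,1]}$ = functions $V\to[0,1]$. $(\Delta u)_i=d_i^{-r}\sum_j\omega_{ij}(u_i-u_j)$, $e^{-\tau\Delta}$ its matrix exponential. $\mathbf 1$ all-ones, $\mathbf 0$ zero function; $\mathcal M(u)=\langle u,\mathbf 1\rangle_{\mathcal V}$; $\bar v=\mathcal M(v)/\mathcal M(\mathbf 1)$. For $u\in\mathcal V_{[0,1]}$, $\mathcal B(u)$ = set of $\beta\in\mathcal V$ with $\beta_i\ge0$ if $u_i=0$, $\beta_i=0$ if $0<u_i<1$, $\beta_i\le0$ if $u_i=1$; $\mathcal B(u)=\emptyset$ otherwise. Semi-discrete iterates with time step $\tau$ and $\lambda=\tau/\varepsilon$: sequences with $\beta^{[\tau]}_{m+1}\in\mathcal B(u^{[\tau]}_{m+1})$ and $u^{[\tau]}_{m+1} -e^{-\tau\Delta}u^{[\tau]}_m-\lambda u^{[\tau]}_{m+1}+\lambda\overline{u^{[\tau]}_{m+1}}\mathbf{1} =\lambda\beta^{[\tau]}_{m+1} -\lambda\overline{\beta^{[\tau]}_{m+1}}\mathbf{1}$ for all $m\ge0$. $H^1_{loc}(T;\mathcal V)$: functions $T\to\mathcal V$ whose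 components lie in $H^1((a,b))$ for all $a,b\in T$, with weak derivative $du/dt$. A pair $(u,\beta)$ is a solution to mass-conserving double-obstacle AC flow on $T$ if $u\in H^1_{loc}(T;\mathcal V)\cap C^0(T;\mathcal V)$, $u(t)\in\mathcal V_{[0,1]}$ for all $t$, and for a.e. $t\in T$: $\varepsilon \frac{du}{dt} + \varepsilon\Delta u(t)-u(t)+\overline{u(t)}\mathbf{1} = \beta(t) - \overline{\beta(t)}\mathbf{1}$ and $\beta(t)\in\mathcal B(u(t))$. *)

(* Defs.v *)
From HB Require Import structures.
From mathcomp Require Import all_boot all_order all_algebra.
From mathcomp Require Import all_classical all_reals all_analysis.
Set Implicit Arguments. Unset Strict Implicit. Unset Printing Implicit Defensive.
Import Order.TTheory GRing.Theory Num.Theory.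
Import numFieldNormedType.Exports.
Local Open Scope classical_set_scope.
Local Open Scope ring_scope.

Section GraphDefs.
Variables (R : realType) (V : finType) (w : V -> V -> R) (r : R).

Definition weighted_graph : Prop :=
  (forall i j, w i j = w j i) /\ (forall i j, 0 <= w i j) /\ (forall i, w i i = 0) /\
  (forall i j, connect [rel x y | 0 < w x y] i j).

Definition deg (i : V) : R := \sum_(j : V) w i j.

Definition ipV (u v : V -> R) : R := \sum_(i : V) u i * v i * (deg i) `^ r.

Definition mass (u : V -> R) : R := ipV u (fun _ => 1).

Definition mean (u : V -> R) : R := mass u / mass (fun _ => 1).

Definition lap (u : V -> R) : V -> R :=
  fun i => (deg i) `^ (- r) * \sum_(j : V) w i j * (u i - u j).

(* e^{-tau Delta} u = sum_k (-tau)^k / k! Delta^k u (the series converges) *)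
Definition heat (tau : R) (u : V -> R) : V -> R :=
  fun i => limn (fun N : nat => \sum_(k < N) ((- tau) ^+ k / (k`!)%:R * iter k lap u i)).

Definition in01 (u : V -> R) : Prop := forall i, 0 <= u i <= 1.

Definition inB (u beta : V -> R) : Prop :=
  in01 u /\ forall i,
    (u i = 0 -> 0 <= beta i) /\ (0 < u i < 1 -> beta i = 0) /\ (u i = 1 -> beta i <= 0).

Definition semi_discrete (eps tau : R) (u0 : V -> R) (u beta : nat -> V -> R) : Prop :=
  u 0%N = u0 /\
  forall m : nat, inB (u m.+1) (beta m.+1) /\
    forall i, u m.+1 i - heat tau (u m) i - (tau / eps) * u m.+1 i
                + (tau / eps) * mean (u m.+1)
              = (tau / eps) * beta m.+1 i - (tau / eps) * mean (beta m.+1).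

End GraphDefs.

Section TimeDefs.
Variable (R : realType).
Notation mu := (@lebesgue_measure R).

Definition L2on (D : set R) (f : R -> R) : Prop :=
  measurable_fun D f /\ (\int[mu]_(x in D) ((f x) ^+ 2)%:E < +oo)%E.

Definition L1on (D : set R) (f : R -> R) : Prop :=
  mu.-integrable D (EFin \o f).

Definition Linfon (D : set R) (f : R -> R) : Prop :=
  measurable_fun D f /\ exists M : R, {ae mu, forall x, D x -> `|f x| <= M}.

Definition test_fun (a b : R) (phi : R -> R) : Prop :=
  (forall (n : nat) (x : R), derivable (derive1n n phi) x 1) /\
  exists c d : R, a < c /\ c <= d /\ d < b /\
    (forall x, (x < c \/ d < x) -> phi x = 0).

Definition weak_deriv (a b : R) (f g : R -> R) : Prop :=
  forall phi, test_fun a b phi ->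
    Rintegral mu `]a, b[ (fun x => f x * derive1 phi x)
    = - Rintegral mu `]a, b[ (fun x => g x * phi x).

Definition H1_with (a b : R) (f g : R -> R) : Prop :=
  L2on `]a, b[ f /\ L2on `]a, b[ g /\ weak_deriv a b f g.
End TimeDefs.

Section FlowDefs.
Variables (R : realType) (V : finType) (w : V -> V -> R) (r : R).
Notation mu := (@lebesgue_measure R).

Definition AC_solution (eps : R) (u beta : R -> V -> R) : Prop :=
  (exists du : R -> V -> R,
     (forall a b : R, 0 <= a -> a < b -> forall i,
         H1_with a b (fun t => u t i) (fun t => du t i)) /\
     {ae mu, forall t, `[0, +oo[%classic t ->
        (forall i, eps * du t i + eps * lap w r (u t) i - u t i + mean w r (u t)
                   = beta t i - mean w r (beta t)) /\
        inB (u t) (beta t)}) /\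
  (forall i, {within `[0, +oo[%classic, continuous (fun t => u t i)}) /\
  (forall t, 0 <= t -> in01 (u t)).

Definition weak_L2loc (f : nat -> R -> V -> R) (g : R -> V -> R) : Prop :=
  forall T : R, 0 < T ->
    (forall n i, L2on `[0, T] (fun t => f n t i)) /\
    (forall i, L2on `[0, T] (fun t => g t i)) /\
    forall phi : R -> V -> R, (forall i, L2on `[0, T] (fun t => phi t i)) ->
      (fun n => Rintegral mu `[0, T] (fun t => ipV w r (f n t) (phi t)))
        @ \oo --> Rintegral mu `[0, T] (fun t => ipV w r (g t) (phi t)).

Definition weakstar_Linfloc (f : nat -> R -> V -> R) (g : R -> V -> R) : Prop :=
  forall T : R, 0 < T ->
    (forall n i, Linfon `[0, T] (fun t => f n t i)) /\
    (forall i, Linfon `[0, T] (fun t => g t i)) /\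
    forall phi : R -> V -> R, (forall i, L1on `[0, T] (fun t => phi t i)) ->
      (fun n => Rintegral mu `[0, T] (fun t => ipV w r (f n t) (phi t)))
        @ \oo --> Rintegral mu `[0, T] (fun t => ipV w r (g t) (phi t)).
End FlowDefs.

(* m = ceil(t / tau) as a natural number (t >= 0, tau > 0) *)
Definition ceil_idx (R : realType) (t tau : R) : nat := `|Num.ceil (t / tau)|%N.

(* Main.v *)
Require Import Defs.
From HB Require Import structures.
From mathcomp Require Import all_boot all_order all_algebra.
From mathcomp Require Import all_classical all_reals all_analysis.
From mathcomp Require Import measurable_realfun.
From mathcomp Require Import lra ring zify.
Import Order.TTheory GRing.Theory Num.Theory.
Import numFieldNormedType.Exports.
Local Open Scope classical_set_scope.
Local Open Scope ring_scope.
Set Implicit Arguments. Unset Strict Implicit. Unset Printing Implicit Defensive.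

(** The interpolants [u_ceil(t/tau)] are uniformly Lipschitz up to O(tau), and
    the [beta]'s are uniformly bounded: mass conservation keeps the mean of [u]
    strictly between 0 and 1, which prevents the mean of [beta] from escaping.
    So along a subsequence the [u]'s converge pointwise and so do the primitives
    of the [beta]'s.  The subsequence is chosen such that, in addition, the inner
    products over each [0, T] of two distinct [beta]'s are summably close to a
    constant.  Expanding squares, the Cesaro means of length N and N' > N are then
    at L^2-distance O(N^(-1/2)), hence the Cesaro means of length 4^k converge
    almost everywhere, and [gamma] is their limit.  Its primitive is the limit of
    the primitives of the [beta]'s, which yields the weak convergences, and the
    flow equation follows by passing to the limit in the summed scheme.  The sign
    conditions on [gamma] are inherited by averages, because the [u]'s converge
    at every time. *)

(** * Bounded measurable functions and their integrals *)

(** Weak convergence of the multipliers is blind to the pointwise conditions in [inB], which is why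
    averages converging almost everywhere are needed. The argument is a quantitative Banach-Saks
    theorem. The constant that the inner products approach stands for the squared norm of [gamma] on
    [0, T], but it never has to be identified: the difference of two Cesaro means has coefficients
    summing to 0, so the constant cancels. The powers 4^k turn the rate N^(-1/2) into the summable
    2^(-k). One subsequence must serve all vertices, all times and all integer horizons T, which
    forces a diagonal choice. The flow equation is linear in [u] and [beta], so convergence of
    primitives suffices for it; the whole nonlinearity sits in [inB]. *)

Section BoundedMeasurable.
Variable R : realType.
Notation mu := (@lebesgue_measure R).

Lemma ae_imply (P Q : R -> Prop) :
  (forall x, P x -> Q x) -> {ae mu, forall x, P x} -> {ae mu, forall x, Q x}.
Proof. by move=> PQ; apply: (@filterS _ _ (ae_filter_ringOfSetsType mu)). Qed.

Lemma ae_and (P Q : R -> Prop) : {ae mu, forall x, P x} -> {ae mu, forall x, Q x} ->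
  {ae mu, forall x, P x /\ Q x}.
Proof. exact: (@filterI _ _ (ae_filter_ringOfSetsType mu)). Qed.

(** Both conditions are asked on the whole line, so that the class is closed under products and its
    members are integrable on every bounded interval. *)
Definition bmeas (f : R -> R) : Prop :=
  measurable_fun setT f /\ exists M, forall x, `|f x| <= M.

Lemma bmeas_cst c : bmeas (fun=> c).
Proof. by split; [exact: measurable_cst|exists `|c|]. Qed.

Lemma bmeasD f g : bmeas f -> bmeas g -> bmeas (fun x => f x + g x).
Proof.
move=> [mf [M fM]] [mg [N gN]]; split; first exact: measurable_funD.
by exists (M + N) => x; rewrite (le_trans (ler_normD _ _))// lerD.
Qed.

Lemma bmeasM f g : bmeas f -> bmeas g -> bmeas (fun x => f x * g x).
Proof.
move=> [mf [M fM]] [mg [N gN]]; split; first exact: measurable_funM.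
by exists (M * N) => x; rewrite normrM ler_pM.
Qed.

Lemma bmeasZ c f : bmeas f -> bmeas (fun x => c * f x).
Proof. by move=> bf; apply: bmeasM => //; exact: bmeas_cst. Qed.

Lemma bmeasN f : bmeas f -> bmeas (fun x => - f x).
Proof.
move=> /(bmeasZ (-1)); rewrite (_ : (fun x => _ * _) = (fun x => - f x))//.
by apply/funext => x; rewrite mulN1r.
Qed.

Lemma bmeasB f g : bmeas f -> bmeas g -> bmeas (fun x => f x - g x).
Proof. by move=> bf bg; apply: bmeasD => //; exact: bmeasN. Qed.

Lemma bmeas_norm f : bmeas f -> bmeas (fun x => `|f x|).
Proof.
move=> [mf [M fM]]; split; first exact: measurableT_comp.
by exists M => x; rewrite normr_id.
Qed.

Lemma bmeas_sum (I : Type) (s : seq I) (P : pred I) (f : I -> R -> R) :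
  (forall i, bmeas (f i)) -> bmeas (fun x => \sum_(i <- s | P i) f i x).
Proof.
move=> bf; elim: s => [|i s IH].
  by under eq_fun do rewrite big_nil; exact: bmeas_cst.
under eq_fun do rewrite big_cons.
by case: (P i) => //; exact: bmeasD.
Qed.

Lemma bmeas_integrable (D : set R) f : measurable D -> (mu D < +oo)%E ->
  bmeas f -> mu.-integrable D (EFin \o f).
Proof.
move=> mD Doo [mf [M fM]]; apply: measurable_bounded_integrable => //.
  exact: measurable_funTS.
by exists M; split; rewrite ?num_real// => x Mx y Dy; exact: le_trans (fM y) (ltW Mx).
Qed.

Lemma mu_itvcc (a b : R) : mu `[a, b] = (Num.max 0 (b - a))%:E.
Proof.
rewrite lebesgue_measure_itv/= lte_fin; case: ltP => ab.
  by rewrite max_r ?subr_ge0 ?ltW// EFinB.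
by rewrite max_l// subr_le0.
Qed.

Lemma bmeas_itv f (a b : R) : bmeas f -> mu.-integrable `[a, b] (EFin \o f).
Proof. by move=> bf; apply: bmeas_integrable => //; rewrite mu_itvcc ltry. Qed.

(** Clamping the argument to [a, b] turns a continuous function, possibly unbounded on the line,
    into a member of [bmeas] with the same values on [a, b]. *)
Lemma bmeas_clamp (psi : R -> R) (a b : R) : a <= b -> continuous psi ->
  bmeas (fun t => psi (Num.max a (Num.min b t))).
Proof.
move=> ab cpsi.
have [K pK] : exists K, forall x, a <= x <= b -> `|psi x| <= K.
  have cw : {within `[a, b], continuous psi} by exact: continuous_subspaceT.
  have [K [_ HK]] := compact_bounded (continuous_compact cw (@segment_compact _ a b)).
  exists (K + 1) => x xab; apply: (HK (K + 1)); first by rewrite ltrDl.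
  by exists x => //=; rewrite in_itv.
split; last first.
  by exists K => x; apply: pK; rewrite le_max lexx/= ge_max ab/= ge_min lexx.
apply: measurableT_comp; first exact: continuous_measurable_fun.
apply: measurable_maxr; first exact: measurable_cst.
by apply: measurable_minr; first exact: measurable_cst.
Qed.

(** Not an oriented integral: for b < a the interval is empty and the value is 0, hence the order
    hypotheses in several lemmas below. *)
Definition itg (f : R -> R) (a b : R) := Rintegral mu `[a, b] f.

Lemma eq_itg f g a b : (forall x, a <= x <= b -> f x = g x) -> itg f a b = itg g a b.
Proof.
by move=> fg; apply: eq_Rintegral => x; rewrite inE/= in_itv/= => /fg.
Qed.

Lemma itgD f g a b : bmeas f -> bmeas g ->
  itg (fun x => f x + g x) a b = itg f a b + itg g a b.
Proof. by move=> bf bg; apply: RintegralD => //; exact: bmeas_itv. Qed.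

Lemma itgZ c f a b : bmeas f -> itg (fun x => c * f x) a b = c * itg f a b.
Proof. by move=> bf; apply: RintegralZl => //; exact: bmeas_itv. Qed.

Lemma itgB f g a b : bmeas f -> bmeas g ->
  itg (fun x => f x - g x) a b = itg f a b - itg g a b.
Proof. by move=> bf bg; apply: RintegralB => //; exact: bmeas_itv. Qed.

Lemma itg_cst c a b : a <= b -> itg (fun=> c) a b = c * (b - a).
Proof.
by move=> ab; rewrite /itg Rintegral_cst//= mu_itvcc /= max_r// subr_ge0.
Qed.

Lemma itg_sum (I : Type) (s : seq I) (P : pred I) (f : I -> R -> R) a b :
  (forall i, bmeas (f i)) ->
  itg (fun x => \sum_(i <- s | P i) f i x) a b = \sum_(i <- s | P i) itg (f i) a b.
Proof.
move=> bf; elim: s => [|i s IH].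
  rewrite big_nil (@eq_itg _ (fun=> 0)); last by move=> x _; rewrite big_nil.
  by rewrite /itg Rintegral_cst// mul0r.
rewrite big_cons; case: ifPn => Pi.
  rewrite -IH -itgD//; last exact: bmeas_sum.
  by apply: eq_itg => x _; rewrite big_cons Pi.
by rewrite -IH; apply: eq_itg => x _; rewrite big_cons (negbTE Pi).
Qed.

Lemma itg_le f g a b : bmeas f -> bmeas g ->
  (forall x, a <= x <= b -> f x <= g x) -> itg f a b <= itg g a b.
Proof.
move=> bf bg fg; apply: le_Rintegral; [by []|exact: bmeas_itv|exact: bmeas_itv|].
by move=> x /=; rewrite in_itv/= => /fg.
Qed.

Lemma itg_norm f a b : bmeas f -> `|itg f a b| <= itg (fun x => `|f x|) a b.
Proof. by move=> bf; apply: le_normr_Rintegral => //; exact: bmeas_itv. Qed.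

Lemma itg_bound f a b K : bmeas f -> a <= b ->
  (forall x, a <= x <= b -> `|f x| <= K) -> `|itg f a b| <= K * (b - a).
Proof.
move=> bf ab fK; rewrite (le_trans (itg_norm _ _ bf))// -itg_cst//.
by apply: itg_le => //; [exact: bmeas_norm|exact: bmeas_cst].
Qed.

Lemma itg_obnd f a b : bmeas f -> \int[mu]_(x in `]a, b]) f x = itg f a b.
Proof.
move=> bf; apply: Rintegral_itv_obnd_cbnd; apply: integrableS (bmeas_itv a b bf) => //.
exact: subset_itv_oc_cc.
Qed.

(** Steps given by a ceiling are constant on left-open, right-closed cells, so the left end has to
    be ignored. *)
Lemma eq_itg_oc f g a b : bmeas f -> bmeas g ->
  (forall x, a < x <= b -> f x = g x) -> itg f a b = itg g a b.
Proof.
move=> bf bg fg; rewrite -!itg_obnd//; apply: eq_Rintegral => x.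
by rewrite inE/= in_itv/= => /fg.
Qed.

Lemma itg_chasles f a b c : bmeas f -> a <= b -> b <= c ->
  itg f a c = itg f a b + itg f b c.
Proof.
move=> bf ab bc; apply/eqP; rewrite addrC -subr_eq; apply/eqP.
rewrite -(itg_obnd b c bf); apply: Rintegral_itvB => //; exact: bmeas_itv.
Qed.

Lemma itg_pt f a : itg f a a = 0.
Proof. by rewrite /itg set_itv1 Rintegral_set1. Qed.

Lemma itg_cvg (f : nat -> R -> R) (g : R -> R) (M a b : R) :
  (forall n, measurable_fun setT (f n)) -> (forall n x, `|f n x| <= M) ->
  bmeas g -> {ae mu, forall x, `[a, b]%classic x -> f ^~ x @ \oo --> g x} ->
  (fun n => itg (f n) a b) @ \oo --> itg g a b.
Proof.
move=> mf fM bg fg.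
have bf n : bmeas (f n) by split => //; exists M.
have [|||||ig _] := @dominated_convergence _ _ _ mu `[a, b]%classic
    (measurable_itv _) (fun n => EFin \o f n) (EFin \o g) (EFin \o cst M).
- by move=> n; apply/measurable_EFinP/measurable_funTS; exact: mf.
- by apply/measurable_EFinP/measurable_funTS; case: bg.
- apply: ae_imply fg => x H /H fx; apply/fine_cvgP; split => //.
  exact: nearW.
- exact/bmeas_itv/bmeas_cst.
- by apply: aeW => x n _ /=; rewrite lee_fin.
rewrite -[X in _ --> X -> _]fineK; first by move=> H; exact: fine_cvg H.
by apply: integrable_fin_num => //; exact: bmeas_itv.
Qed.

End BoundedMeasurable.

(** * Diagonal subsequences *)

Section Diagonal.
Variable R : realType.

Definition geo (n : nat) : R := 2^-1 ^+ n.

Lemma geo_gt0 n : 0 < geo n.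
Proof. by rewrite exprn_gt0// invr_gt0. Qed.

Lemma geo_cvg0 : geo @ \oo --> 0.
Proof.
have -> : geo = GRing.exp 2^-1 by [].
by apply: cvg_expr; rewrite ger0_norm ?invr_ge0// invf_lt1// ltr1n.
Qed.

Lemma sum_geo n : \sum_(i < n) geo i <= 2.
Proof.
suff -> : \sum_(i < n) geo i = 2 - 2 * geo n by rewrite gerBl mulr_ge0// ltW// geo_gt0.
elim: n => [|n IH]; first by rewrite big_ord0 /geo expr0 mulr1 subrr.
rewrite big_ord_recr/= IH /geo exprS mulrA mulfV// mul1r; ring.
Qed.

(** Compactness gives a cluster point; an ultrafilter contains the preimage of each neighbourhood or
    its complement, and the complement would contradict clustering. *)
Lemma ultra_bounded_cvg (U : set_system nat) (UU : UltraFilter U) (x : nat -> R) (C : R) :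
  (forall n, `|x n| <= C) -> exists l : R, x @ U --> l.
Proof.
move=> xC; have UF : ProperFilter U by exact: ultra_proper.
have [|l [_ xl]] := @segment_compact R (- C) C (fmap x U) _.
  rewrite /fmap /= (_ : _ @^-1` _ = setT); first exact: filterT.
  by apply/seteqP; split => // n _; rewrite /= in_itv/= -ler_norml.
exists l => N lN; have [//|UN] := in_ultra_setVsetC (x @^-1` N) UU.
have [] := xl (~` N) N _ lN; first exact: UN.
by move=> p [].
Qed.

Variables (K : countType) (x : K -> nat -> R) (C : K -> R).
Variables (a : K -> nat -> nat -> R) (D : K -> R).

(* An ultrafilter limit prescribes all the limits at once, so a single run of
   choices replaces an iterated choice of subsequences followed by a diagonal argument. *)
Lemma diagonal_subsequence :
  (forall k n, `|x k n| <= C k) -> (forall k m n, `|a k m n| <= D k) ->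
  exists (sigma : nat -> nat) (y z : K -> R),
    (forall n, (sigma n < sigma n.+1)%N) /\
    forall k n, (pickle k <= n)%N -> `|x k (sigma n) - y k| <= geo n /\
      forall i, (pickle k <= i)%N -> (i < n)%N ->
        `|a k (sigma i) (sigma n) - z k| <= geo i + geo n.
Proof.
move=> xC aD.
have [U [UU ooU]] := @ultraFilterLemma nat (\oo : set_system nat) _.
have UP : ProperFilter U by exact: ultra_proper.
have /choice[y yP] : forall k, exists l : R, x k @ U --> l.
  by move=> k; exact: (ultra_bounded_cvg UU (xC k)).
have /choice[z1 z1P] : forall km : K * nat, exists l : R, a km.1 km.2 @ U --> l.
  by move=> [k m]; exact: (ultra_bounded_cvg UU (aD k m)).
have z1D k m : `|z1 (k, m)| <= D k.
  by have /cvg_norm H := z1P (k, m); apply: (cvgr_to_le H); exact: nearW.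
(* [z k] is the iterated limit of [a k m n], in n and then in m; the inner limits inherit the bound
   [D k], so the outer one exists. *)
have /choice[z zP] : forall k, exists l : R, (fun m => z1 (k, m)) @ U --> l.
  by move=> k; exact: (ultra_bounded_cvg UU (z1D k)).
(* [s] lists the indices chosen so far; its length fixes both the precision and the finitely many
   [k] under control. *)
pose P (s : seq nat) n := all (fun m => (m < n)%N) s /\
  forall k, (pickle k <= size s)%N -> `|x k n - y k| <= geo (size s) /\
    `|z1 (k, n) - z k| <= geo (size s) /\
    forall m, m \in s -> `|a k m n - z1 (k, m)| <= geo (size s).
have close (v : nat -> R) l e : 0 < e -> v @ U --> l -> U [set n | `|v n - l| <= e].
  move=> e0 /cvgrPdist_le/(_ _ e0); apply: filterS => n /=.
  by rewrite distrC.
have PU s : U (P s).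
  apply: filterI.
    apply: ooU; exists (\max_(m <- s) m).+1 => // n /= sn.
    by apply/allP => m ms; apply: leq_trans sn; rewrite ltnS; exact: leq_bigmax_seq.
  (* Injectivity of [pickle] leaves finitely many [k] to serve; ranging over ordinals makes this a
     finite intersection, vacuous at numbers that code no [k]. *)
  have : \forall n \near U, forall j : 'I_(size s).+1, forall k, pickle k = j ->
    `|x k n - y k| <= geo (size s) /\
    `|z1 (k, n) - z k| <= geo (size s) /\
    forall m, m \in s -> `|a k m n - z1 (k, m)| <= geo (size s).
    apply: filter_forall => j.
    have [[k kj]|nk] := pselect (exists k : K, pickle k = j); last first.
      by apply: nearW => n k kj; case: nk; exists k.
    have H1 := close _ _ _ (geo_gt0 (size s)) (yP k).
    have H2 := close _ _ _ (geo_gt0 (size s)) (zP k).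
    have H3 : \forall n \near U, forall i : 'I_(size s),
        `|a k (nth 0%N s i) n - z1 (k, nth 0%N s i)| <= geo (size s).
      apply: filter_forall => i.
      exact: (close _ _ _ (geo_gt0 (size s)) (z1P (k, nth 0%N s i))).
    apply: filterS (filterI H1 (filterI H2 H3)) => n /= [h1 [h2 h3]] k'.
    rewrite -kj => /(pcan_inj pickleK) ->; split=> //; split=> // m ms.
    have im : (index m s < size s)%N by rewrite index_mem.
    by have := h3 (Ordinal im); rewrite /= nth_index.
  apply: filterS => n H k kS.
  by have := H (Ordinal (kS : (pickle k < (size s).+1)%N)) k erefl.
have /choice[next nextP] : forall s, exists n, P s n.
  by move=> s; exact: (filter_ex (PU s)).
(* The whole history is kept because a new index must be paired with every earlier one. *)
pose hist := fix hist n := if n is m.+1 then rcons (hist m) (next (hist m)) else [::].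
pose sigma n := next (hist n).
have histS n : size (hist n) = n.
  by elim: n => [|n IH] /=; [|rewrite size_rcons IH].
have sh m n : (m < n)%N -> sigma m \in hist n.
  elim: n => // n IH; rewrite ltnS leq_eqVlt /= mem_rcons inE => /predU1P[->|/IH ->].
    by rewrite eqxx.
  by rewrite orbT.
exists sigma, y, z; split=> [n|k n kn].
  by have [/allP/(_ (sigma n) (sh _ _ (ltnSn n)))] := nextP (hist n.+1).
have [_] := nextP (hist n); rewrite -/(sigma n) histS => /(_ k kn) [? [_ H]].
split=> // i ki iin.
have [_] := nextP (hist i); rewrite -/(sigma i) histS => /(_ k ki) [_ [H' _]].
(* Through [z1 (k, sigma i)] the error splits into [geo n], secured when [sigma n] was chosen, and
   [geo i], secured when [sigma i] was. *)
rewrite -(subrKA (z1 (k, sigma i))) (le_trans (ler_normD _ _))// addrC lerD//.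
exact/H/sh.
Qed.

End Diagonal.

(** * Almost everywhere convergence of Cesaro means *)

Section Cesaro.
Variable R : realType.
Notation mu := (@lebesgue_measure R).
Variables (f : nat -> R -> R) (M : R).
Hypothesis mf : forall n, measurable_fun setT (f n).
Hypothesis fM : forall n x, `|f n x| <= M.

Let bf n : bmeas (f n). Proof. by split => //; exists M. Qed.

Definition cmean (N : nat) (x : R) : R := N%:R^-1 * \sum_(n < N) f n x.

(** Off the diagonal the Gram matrix on [0, T] is constant up to summable errors, on the diagonal
    only up to a bounded one. For a weakly convergent sequence [z] is the squared norm of the
    limit. *)
Definition almost_gram (T : R) : Prop := exists (z : R) (e : nat -> R) (E B : R),
  [/\ forall n, 0 <= e n, forall n, \sum_(i < n) e i <= E,
      forall i j, (i < j)%N -> `|itg (fun x => f i x * f j x) 0 T - z| <= e i + e j &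
      forall i, `|itg (fun x => f i x * f i x) 0 T - z| <= B].

Lemma bmeas_cmean N : bmeas (cmean N).
Proof. by apply: bmeasZ; exact: bmeas_sum. Qed.

Lemma cmean_bound N x : `|cmean N x| <= M.
Proof.
have M0 : 0 <= M := le_trans (normr_ge0 _) (fM 0 x).
have [->|N0] := posnP N; first by rewrite /cmean big_ord0 mulr0 normr0.
rewrite normrM ger0_norm ?invr_ge0// ler_pdivrMl ?ltr0n//.
rewrite (le_trans (ler_norm_sum _ _ _))// (@le_trans _ _ (\sum_(i < N) M))//.
  by apply: ler_sum => i _; exact: fM.
by rewrite sumr_const card_ord mulr_natl.
Qed.

Lemma itg_sqr_comb (c : nat -> R) K a b :
  itg (fun x => (\sum_(i < K) c i * f i x) ^+ 2) a b =
  \sum_(i < K) \sum_(j < K) c i * c j * itg (fun x => f i x * f j x) a b.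
Proof.
rewrite (@eq_itg _ _ (fun x => \sum_(i < K) \sum_(j < K) (c i * c j) * (f i x * f j x))).
  rewrite itg_sum => [|i]; last first.
    by apply: bmeas_sum => j; apply: bmeasZ; exact: bmeasM.
  apply: eq_bigr => i _; rewrite itg_sum => [|j]; last by apply: bmeasZ; exact: bmeasM.
  by apply: eq_bigr => j _; rewrite itgZ//; exact: bmeasM.
move=> x _; rewrite expr2 big_distrlr/=; apply: eq_bigr => i _.
by apply: eq_bigr => j _; rewrite mulrACA.
Qed.

(** The coefficients [c] of the difference sum to 0, so [z] can be subtracted from every entry. With
    |c_i| <= 1/N and the sum of the |c_i| at most 2, the off-diagonal errors cost at most 4E/N and
    the diagonal ones 2B/N. *)
Lemma cmean_sqr_dist T : almost_gram T -> exists C, forall N K, (0 < N <= K)%N ->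
  itg (fun x => (cmean N x - cmean K x) ^+ 2) 0 T <= C / N%:R.
Proof.
move=> [z [e [E [B [e0 eE fe fB]]]]]; exists (4 * E + 2 * B) => N K /andP[N0 NK].
have K0 : (0 < K)%N by exact: leq_trans NK.
pose c (i : nat) : R := (if (i < N)%N then N%:R^-1 else 0) - K%:R^-1.
have sumN (g : nat -> R) : \sum_(i < K) (if (i < N)%N then g i else 0) = \sum_(i < N) g i.
  by rewrite -big_mkcond/= (big_ord_widen_cond _ (fun=> true) g NK).
rewrite (@eq_itg _ _ (fun x => (\sum_(i < K) c i * f i x) ^+ 2)); last first.
  move=> x _; congr (_ ^+ 2); rewrite /c.
  under eq_bigr do rewrite mulrBl; rewrite sumrB -mulr_sumr; congr (_ - _).
  rewrite /cmean mulr_sumr -(sumN (fun i => N%:R^-1 * f i x)).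
  by apply: eq_bigr => i _; case: ifP; rewrite ?mul0r.
rewrite itg_sqr_comb.
have Ni : 0 < N%:R^-1 :> R by rewrite invr_gt0 ltr0n.
have Ki : 0 < K%:R^-1 :> R by rewrite invr_gt0 ltr0n.
have KNi : K%:R^-1 <= N%:R^-1 :> R by rewrite lef_pV2 ?posrE ?ltr0n// ler_nat.
have cN i : `|c i| <= N%:R^-1.
  rewrite /c; case: ifP => _; last by rewrite sub0r normrN gtr0_norm.
  by rewrite ger0_norm ?subr_ge0// gerBl ltW.
have sumK : \sum_(i < K) (if (i < N)%N then N%:R^-1 else 0) = 1 :> R.
  rewrite (sumN (fun=> N%:R^-1)) sumr_const card_ord -[LHS]mulr_natr mulVf//.
  by rewrite pnatr_eq0 -lt0n.
have sumK' : \sum_(i < K) K%:R^-1 = 1 :> R.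
  by rewrite sumr_const card_ord -[LHS]mulr_natr mulVf// pnatr_eq0 -lt0n.
have c0 : \sum_(i < K) c i = 0 by rewrite sumrB sumK sumK' subrr.
have c2 : \sum_(i < K) `|c i| <= 2.
  rewrite (_ : 2 = \sum_(i < K) ((if (i < N)%N then N%:R^-1 else 0) + K%:R^-1)).
    apply: ler_sum => i _.
    rewrite /c (le_trans (ler_normB _ _))// (gtr0_norm Ki) lerD2r.
    by case: ifP; rewrite ?normr0// gtr0_norm.
  by rewrite big_split/= sumK sumK'.
have E0 : 0 <= E by have := eE 0%N; rewrite big_ord0.
have ce : \sum_(i < K) `|c i| * e i <= E / N%:R.
  rewrite mulrC; apply: (@le_trans _ _ (\sum_(i < K) N%:R^-1 * e i)).
    by apply: ler_sum => i _; rewrite ler_wpM2r.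
  by rewrite -mulr_sumr ler_wpM2l// ltW.
have B0 : 0 <= B := le_trans (normr_ge0 _) (fB 0%N).
rewrite (_ : \sum_(i < K) _ = \sum_(i < K) \sum_(j < K)
    c i * c j * (itg (fun x => f i x * f j x) 0 T - z)); last first.
  apply/eqP; rewrite -subr_eq0 -sumrB.
  under eq_bigr => i _.
    rewrite -sumrB; under eq_bigr do rewrite -mulrBr opprB addrCA subrr addr0.
    rewrite -mulr_suml -mulr_sumr c0 mulr0 mul0r.
    over.
  by rewrite big1.
have S : 4 * E / N%:R + 2 * B / N%:R =
  (E / N%:R * 2 + 2 * (E / N%:R)) + B * (N%:R^-1 * 2) by lra.
rewrite mulrDl S.
apply: (@le_trans _ _ (\sum_(i < K) \sum_(j < K)
    (`|c i| * e i * `|c j| + `|c i| * (`|c j| * e j) +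
     B * (`|c i| * `|c j| * (i == j)%:R)))).
  apply: ler_sum => i _; apply: ler_sum => j _.
  rewrite (le_trans (ler_norm _))// !normrM.
  rewrite (_ : _ + _ = `|c i| * `|c j| * (e i + e j + B * (i == j)%:R)); last by ring.
  rewrite ler_wpM2l ?mulr_ge0//.
  have [ij|ij|/val_inj ->] := ltngtP i j.
  - by rewrite (le_trans (fe _ _ ij))// lerDl mulr_ge0.
  - rewrite (@eq_itg _ _ (fun x => f j x * f i x)); last by move=> x _; rewrite mulrC.
    by rewrite (le_trans (fe _ _ ij))// [e j + _]addrC lerDl mulr_ge0.
  - by rewrite eqxx mulr1 (le_trans (fB _))// lerDr addr_ge0.
under eq_bigr do rewrite !big_split/= -!mulr_sumr.
rewrite !big_split/= -!mulr_suml -mulr_sumr.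
have cs : 0 <= \sum_(i < K) `|c i| by apply: sumr_ge0.
have ces : 0 <= \sum_(i < K) `|c i| * e i by apply: sumr_ge0 => i _; rewrite mulr_ge0.
apply: lerD; first by apply: lerD; exact: ler_pM.
apply: ler_wpM2l => //.
rewrite mulrC; apply: (@le_trans _ _ (\sum_(i < K) `|c i| * N%:R^-1)); last first.
  by rewrite -mulr_suml ler_wpM2r// ltW.
apply: ler_sum => i _; rewrite (bigD1 i)//= eqxx mulr1 big1 ?addr0; last first.
  by move=> j ji; rewrite eq_sym (negbTE ji) mulr0.
by rewrite ler_wpM2l.
Qed.

(** Successive means along 4^k differ by at most (C + T) 2^(-k) in L^1, so the sum of their
    distances is integrable and the telescoping series converges absolutely almost everywhere. *)
Lemma cmean_ae_cvg T : 0 <= T -> almost_gram T ->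
  {ae mu, forall x, `[0, T]%classic x -> cvgn (fun k => cmean (4 ^ k) x)}.
Proof.
move=> T0 /cmean_sqr_dist[C HC].
pose d k x := `|cmean (4 ^ k) x - cmean (4 ^ k.+1) x|.
have bd k : bmeas (d k) by apply: bmeas_norm; apply: bmeasB; exact: bmeas_cmean.
have dC k : itg (d k) 0 T <= (C + T) * geo R k.
  (* The weight [q] balances q C / 4^k against T / q: both are of order 2^(-k). *)
  pose q : R := 2 ^+ k; have q0 : 0 < q by rewrite exprn_gt0.
  have gq : geo R k = q^-1 by rewrite /geo exprVn.
  have b2 : bmeas (fun x => (cmean (4 ^ k) x - cmean (4 ^ k.+1) x) ^+ 2).
    by apply: bmeasM; apply: bmeasB; exact: bmeas_cmean.
  apply: (@le_trans _ _ (itg (fun x => q * (cmean (4 ^ k) x - cmean (4 ^ k.+1) x) ^+ 2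
                                + q^-1) 0 T)).
    apply: itg_le => // [|x _]; first by apply: bmeasD; [exact: bmeasZ|exact: bmeas_cst].
    rewrite -real_normK ?num_real// -/(d k x).
    (* AM-GM, so that no Cauchy-Schwarz inequality is needed *)
    have -> : q * d k x ^+ 2 + q^-1 = d k x + q^-1 * ((q * d k x - 2^-1) ^+ 2 + 3/4).
      by field; rewrite gt_eqF.
    by rewrite lerDl mulr_ge0 ?invr_ge0 ?(ltW q0)// addr_ge0 ?sqr_ge0// divr_ge0.
  rewrite itgD; [|exact: bmeasZ|exact: bmeas_cst].
  rewrite itgZ// itg_cst// subr0 gq mulrDl [T * _]mulrC lerD2r.
  have /HC H : (0 < 4 ^ k <= 4 ^ k.+1)%N by rewrite expn_gt0/= leq_exp2l.
  rewrite -(ler_pM2l q0) in H; apply: (le_trans H).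
  have -> : (4 ^ k)%:R = q * q :> R by rewrite -exprMn -natrM natrX.
  have -> : q * (C / (q * q)) = C * q^-1 by field; rewrite gt_eqF.
  by [].
(* No sign is known for [C]; that of C + T is read off the estimate at k = 0. *)
have CT : 0 <= C + T.
  have := dC 0%N; rewrite /geo expr0 mulr1; apply: le_trans.
  by apply: Rintegral_ge0 => x _; rewrite normr_ge0.
have dE k : (\int[mu]_(x in `[0%R, T]) (d k x)%:E = (itg (d k) 0 T)%:E)%E.
  by rewrite fineK//; apply: integrable_fin_num => //; exact: bmeas_itv.
have md k : measurable_fun `[0, T] (EFin \o d k).
  by apply/measurable_EFinP/measurable_funTS; case: (bd k).
have isum : mu.-integrable `[0, T] (fun x => \sum_(k <oo) (d k x)%:E)%E.
  apply/integrableP; split.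
    apply: (@ge0_emeasurable_sum _ _ _ _ (fun k => EFin \o d k)) => [k x _ _|k _].
      by rewrite lee_fin normr_ge0.
    exact: md.
  have absE x : (`|\sum_(k <oo) (d k x)%:E| = \sum_(k <oo) (d k x)%:E)%E.
    by rewrite gee0_abs//; apply: nneseries_ge0 => k _ _; rewrite lee_fin normr_ge0.
  under eq_integral do rewrite absE.
  rewrite integral_nneseries//; last by move=> k x _; rewrite lee_fin normr_ge0.
  apply: (@le_lt_trans _ _ ((C + T) * 2)%:E); last exact: ltry.
  apply: lime_le.
    by apply: is_cvg_nneseries => k _ _; apply: integral_ge0 => x _; rewrite lee_fin normr_ge0.
  apply: nearW => n; under eq_bigr do rewrite dE.
  rewrite sumEFin lee_fin big_mkord.
  apply: (@le_trans _ _ (\sum_(k < n) (C + T) * geo R k)); first exact: ler_sum.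
  by rewrite -mulr_sumr ler_wpM2l// sum_geo.
have fin_ae : {ae mu, forall x, `[0, T]%classic x ->
    (\sum_(k <oo) (d k x)%:E)%E \is a fin_num}.
  by apply: integrable_ae => //; exact: measurable_itv.
apply: ae_imply fin_ae => x H /H fin.
pose v k := cmean (4 ^ k.+1) x - cmean (4 ^ k) x.
have cv : cvgn (series v).
  apply: normed_cvg; apply: nondecreasing_is_cvgn.
    apply/nondecreasing_seqP => n.
    by rewrite /normed_series_of seriesSr lerDl normr_ge0.
  exists (fine (\sum_(k <oo) (d k x)%:E)%E) => _ [n _ <-].
  rewrite -lee_fin fineK// /normed_series_of seriesEnat/= -sumEFin.
  under eq_bigr do rewrite distrC.
  by apply: nneseries_lim_ge => k _ _; rewrite lee_fin normr_ge0.
have -> : (fun k => cmean (4 ^ k) x) = (fun k => cmean (4 ^ 0) x + series v k).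
  by apply/funext => k; rewrite [LHS](eq_sum_telescope (fun k => cmean (4 ^ k) x)).
apply: is_cvgD => //; exact: is_cvg_cst.
Qed.

Lemma cesaro_limit : (forall T : nat, almost_gram T%:R) ->
  exists g : R -> R, [/\ measurable_fun setT g, forall x, `|g x| <= M &
    {ae mu, forall x, 0 <= x -> (fun k => cmean (4 ^ k) x) @ \oo --> g x}].
Proof.
move=> gram.
(* The upper limit is measurable before convergence is known and equals the limit where there is
   one; clamping it to [-M, M] bounds the witness at every point. *)
pose s x := limn_sup (fun k => cmean (4 ^ k) x).
exists (fun x => Num.max (- M) (Num.min M (s x))); split.
- apply: measurable_maxr; first exact: measurable_cst.
  apply: measurable_minr; first exact: measurable_cst.
  apply: (@measurable_fun_limn_sup _ _ _ setT (fun k => cmean (4 ^ k))).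
  + move=> x _; exists M => _ [k _ <-]; exact: le_trans (ler_norm _) (cmean_bound _ _).
  + move=> x _; exists (- M) => _ [k _ <-].
    by have := cmean_bound (4 ^ k) x; rewrite ler_norml => /andP[].
  + by move=> k; have [] := bmeas_cmean (4 ^ k).
- move=> x; have M0 : 0 <= M := le_trans (normr_ge0 _) (fM 0 x).
  rewrite ler_norml le_max lexx/= ge_max ge_min lexx/=.
  by rewrite (le_trans _ M0)// oppr_le0.
have H : {ae mu, forall x, forall T : nat, `[0, T%:R]%classic x ->
    cvgn (fun k => cmean (4 ^ k) x)}.
  by apply: ae_foralln => T; exact: cmean_ae_cvg.
apply: ae_imply H => x cx x0.
have {}cx : cvgn (fun k => cmean (4 ^ k) x).
  apply: (cx (Num.truncn x).+1) => /=; rewrite in_itv/= x0/= ltW//.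
  exact: truncnS_gt.
rewrite /s (cvg_limn_supE cx).
set l := limn _.
have lM : `|l| <= M.
  by apply: (cvgr_to_le (cvg_norm cx)); apply: nearW => k; exact: cmean_bound.
by move: lM; rewrite ler_norml => /andP[l1 l2]; rewrite min_r// max_r.
Qed.

End Cesaro.

(** * Step functions and weak convergence *)

Lemma cvg_sumr (R : realType) (I : Type) (s : seq I) (P : pred I)
    (F : I -> nat -> R) (l : I -> R) :
  (forall i, F i @ \oo --> l i) ->
  (fun n => \sum_(i <- s | P i) F i n) @ \oo --> \sum_(i <- s | P i) l i.
Proof.
move=> Fl; elim: s => [|i s IH].
  by rewrite big_nil; under eq_fun do rewrite big_nil; exact: cvg_cst.
rewrite big_cons; under eq_fun do rewrite big_cons.
by case: (P i) => //; exact: cvgD.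
Qed.

Section StepFunctions.
Variable R : realType.
Notation mu := (@lebesgue_measure R).
Variable h : R.
Hypothesis h0 : 0 < h.

Lemma ceil_idx_le0 : ceil_idx 0 h = 0%N.
Proof. by rewrite /ceil_idx mul0r ceil0. Qed.

Lemma ceil_idxE (t : R) (m : nat) : m%:R * h < t <= m.+1%:R * h -> ceil_idx t h = m.+1.
Proof.
move=> /andP[mt tm]; rewrite /ceil_idx (_ : Num.ceil _ = m.+1%:Z)//.
apply: ceil_def; rewrite ltr_pdivlMr// ler_pdivrMr// tm andbT.
by rewrite rmorphB /= -[m.+1%:Z%:~R]/(m.+1%:R) -natr1 addrK.
Qed.

Lemma ceil_idx_bounds (t : R) : 0 <= t -> t <= (ceil_idx t h)%:R * h < t + h.
Proof.
move=> t0; have c0 : 0 <= Num.ceil (t / h).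
  by rewrite ceil_ge0 (lt_le_trans (ltrN10 _))// divr_ge0// ltW.
have e : (ceil_idx t h)%:R = (Num.ceil (t / h))%:~R :> R.
  by rewrite /ceil_idx pmulrn /= gez0_abs.
rewrite e -ler_pdivrMr// ceil_ge/= -ltr_pdivlMr// mulrDl divff ?gt_eqF//.
by have := ceilB1_lt (t / h); rewrite ?intrD ?rmorphB/= ltrBlDr.
Qed.

Lemma ceil_idx_gt0 (t : R) : 0 < t -> (0 < ceil_idx t h)%N.
Proof.
move=> t0; have /andP[+ _] := ceil_idx_bounds (ltW t0).
by case: (ceil_idx t h) => //; rewrite mul0r leNgt t0.
Qed.

Lemma measurable_step (c : nat -> R) : measurable_fun setT (fun t => c (ceil_idx t h)).
Proof.
move=> _ A mA; rewrite setTI.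
(* [ceil_idx] takes the absolute value of the ceiling, so negative times also see [c]: index m is
   attained on the cells of ceiling m and of ceiling -m. *)
have -> : (fun t => c (ceil_idx t h)) @^-1` A =
    \bigcup_(m in [set m | A (c m)])
      ([set` `](m%:R - 1) * h, m%:R * h]] `|` [set` `](- m%:R - 1) * h, - m%:R * h]]).
  have ceilP (t : R) (z : int) :
      Num.ceil (t / h) = z <-> (z%:~R - 1) * h < t <= z%:~R * h.
    rewrite -ltr_pdivlMr// -ler_pdivrMr//; split=> [<-|H].
      by rewrite ceil_ge andbT; have := ceilB1_lt (t / h); rewrite rmorphB.
    by apply: ceil_def; rewrite rmorphB.
  apply/seteqP; split => [t /= At|t [m /= Am]].
    exists (ceil_idx t h) => //=; rewrite !in_itv /=.
    have /ceilP H : Num.ceil (t / h) = Num.ceil (t / h) by [].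
    rewrite /ceil_idx; case: (Num.ceil (t / h)) H => n H /=; first by left.
    by right; move: H; rewrite NegzE rmorphN.
  rewrite /= !in_itv /= => -[|] H; rewrite /ceil_idx.
    by have /ceilP -> : (m%:Z%:~R - 1) * h < t <= m%:Z%:~R * h by [].
  have /ceilP -> : ((- m%:Z)%:~R - 1) * h < t <= (- m%:Z)%:~R * h by rewrite rmorphN.
  by rewrite abszN.
apply: bigcup_measurable => m _; apply: measurableU; exact: measurable_itv.
Qed.

Lemma bmeas_step (c : nat -> R) (K : R) : (forall m, `|c m| <= K) ->
  bmeas (fun t => c (ceil_idx t h)).
Proof. by move=> cK; split; [exact: measurable_step|exists K]. Qed.

(** On the domain of integration the value [c 0] is seen only at the point 0 and drops out, whence
    the shifted index [c j.+1]. *)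
Lemma itg_mul_step (f : R -> R) (c : nat -> R) (K : R) (m : nat) :
  bmeas f -> (forall m, `|c m| <= K) ->
  itg (fun t => f t * c (ceil_idx t h)) 0 (m%:R * h) =
  \sum_(j < m) c j.+1 * itg f (j%:R * h) (j.+1%:R * h).
Proof.
move=> bf cK; have bc := bmeas_step cK; have bfc := bmeasM bf bc.
elim: m => [|m IH]; first by rewrite big_ord0 mul0r itg_pt.
have m0 : 0 <= m%:R * h by rewrite mulr_ge0// ltW.
have mm : m%:R * h <= m.+1%:R * h by rewrite ler_wpM2r ?ler_nat// ltW.
rewrite (itg_chasles bfc m0 mm) IH big_ord_recr/=; congr (_ + _).
rewrite -itgZ//; apply: eq_itg_oc => //; first exact: bmeasZ.
by move=> x /ceil_idxE ->; rewrite mulrC.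
Qed.

End StepFunctions.

Lemma bmeasM_integrable (R : realType) (D : set R) (b g : R -> R) :
  measurable D -> bmeas b -> (@lebesgue_measure R).-integrable D (EFin \o g) ->
  (@lebesgue_measure R).-integrable D (EFin \o (fun t => b t * g t)).
Proof.
move=> mD [mb [M bM]] ig.
apply: (@integrableMr _ _ _ (@lebesgue_measure R) _ mD b (EFin \o g)) => //.
  by apply: measurable_funTS; exact: mb.
by exists M; split; rewrite ?num_real// => y My x _; exact: le_trans (bM x) (ltW My).
Qed.

Section WeakConvergence.
Variable R : realType.
Notation mu := (@lebesgue_measure R).
Variables (f : nat -> R -> R) (M T : R).
Hypothesis T0 : 0 < T.
Hypothesis mf : forall n, measurable_fun setT (f n).
Hypothesis fM : forall n x, `|f n x| <= M.
Hypothesis fprim : forall t, 0 <= t <= T -> (fun n => itg (f n) 0 t) @ \oo --> 0.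

Let bf n : bmeas (f n). Proof. by split => //; exists M. Qed.

(** On each cell the integral of [f n] is a difference of two primitives, and both tend to 0. *)
Lemma weak_cvg_step (c : nat -> R) (K : R) (k : nat) : (forall m, `|c m| <= K) ->
  (fun n => itg (fun t => f n t * c (ceil_idx t (T / k.+1%:R))) 0 T) @ \oo --> 0.
Proof.
move=> cK; set h := T / _; have h0 : 0 < h by rewrite divr_gt0.
have TE : T = k.+1%:R * h by rewrite mulrC /h divfK// pnatr_eq0.
have -> : (fun n => itg (fun t => f n t * c (ceil_idx t h)) 0 T) = (fun n =>
    \sum_(j < k.+1) c j.+1 * itg (f n) (j%:R * h) (j.+1%:R * h)).
  by apply/funext => n; rewrite {1}TE (itg_mul_step h0 _ (bf n) cK).
suff H : (fun n => \sum_(j < k.+1) c j.+1 * itg (f n) (j%:R * h) (j.+1%:R * h)) @ \oo -->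
    \sum_(j < k.+1) c j.+1 * (0 - 0).
  by move: H; rewrite big1// => j _; rewrite subr0 mulr0.
apply: cvg_sumr => j; apply: cvgM; first exact: cvg_cst.
have j0 : 0 <= j%:R * h by rewrite mulr_ge0// ltW.
have jj : j%:R * h <= j.+1%:R * h by rewrite ler_wpM2r ?ler_nat// ltW.
have jT : j.+1%:R * h <= T by rewrite TE ler_wpM2r ?ler_nat// ltW.
have -> : (fun n => itg (f n) (j%:R * h) (j.+1%:R * h)) =
  (fun n => itg (f n) 0 (j.+1%:R * h) - itg (f n) 0 (j%:R * h)).
  by apply/funext => n; rewrite (itg_chasles (bf n) j0 jj) addrAC subrr add0r.
apply: cvgB; apply: fprim; first by rewrite jT (le_trans j0 jj).
by rewrite j0 (le_trans jj jT).
Qed.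

(** The uniform bound on [f n] turns L^1-closeness of test functions into closeness of the
    integrals, uniformly in n; the grid can thus be fixed before n grows. *)
Lemma weak_cvg_continuous (psi : R -> R) : continuous psi ->
  (fun n => itg (fun t => f n t * psi (Num.max 0 (Num.min T t))) 0 T) @ \oo --> 0.
Proof.
move=> cpsi; pose p t := psi (Num.max 0 (Num.min T t)).
suff : (fun n => itg (fun t => f n t * p t) 0 T) @ \oo --> 0 by [].
have bp : bmeas p by apply: bmeas_clamp => //; exact: ltW.
have [_ [K pK]] := bp.
pose h k : R := T / k.+1%:R; have h0 k : 0 < h k by rewrite divr_gt0.
pose c k m := p (m%:R * h k).
have bs k : bmeas (fun t => c k (ceil_idx t (h k))).
  by apply: (bmeas_step (h0 k) (K := K)) => m; apply: pK.
have M0 : 0 <= M := le_trans (normr_ge0 _) (fM 0 0).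
have cp (x : R) : {for x, continuous p}.
  apply: continuous_comp; last exact: cpsi.
  apply: continuous_max; first exact: cvg_cst.
  by apply: continuous_min; [exact: cvg_cst|exact: cvg_id].
have grid (x : R) : 0 <= x -> (fun k => (ceil_idx x (h k))%:R * h k) @ \oo --> x.
  move=> x0; apply/cvgrPdist_le => e e0; near=> k.
  have /andP[x1 x2] := ceil_idx_bounds (h0 k) x0.
  rewrite distrC ger0_norm ?subr_ge0// lerBlDl (le_trans (ltW x2))// lerD2l.
  rewrite /h ler_pdivrMr// -ler_pdivrMl//.
  rewrite mulrC -natr1 (@le_trans _ _ k%:R)// ?lerDl//.
  by near: k; exact: nbhs_infty_ger.
(* step functions on finer and finer grids converge boundedly to [psi] *)
have pointwise (x : R) : 0 <= x ->
    (fun k => `|p x - c k (ceil_idx x (h k))|) @ \oo --> 0.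
  move=> /grid H.
  suff : (fun k => `|p x - c k (ceil_idx x (h k))|) @ \oo --> `|p x - p x|.
    by rewrite subrr normr0.
  apply: cvg_norm; apply: cvgB; first exact: cvg_cst.
  exact: (cvg_comp _ _ H (cp x)).
have stepcvg : (fun k => itg (fun t => `|p t - c k (ceil_idx t (h k))|) 0 T) @ \oo --> 0.
  suff : (fun k => itg (fun t => `|p t - c k (ceil_idx t (h k))|) 0 T) @ \oo -->
      itg (fun=> 0) 0 T by rewrite itg_cst ?(ltW T0)// mul0r.
  apply: (@itg_cvg _ _ _ (K + K)) => [k|k x||].
  - by have [] := bmeas_norm (bmeasB bp (bs k)).
  - by rewrite normr_id (le_trans (ler_normB _ _))// lerD//; apply: pK.
  - exact: bmeas_cst.
  by apply: aeW => x /=; rewrite in_itv/= => /andP[x0 xT]; exact: pointwise.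
apply/cvgrPdist_le => e e0.
have e2 : 0 < e / 2 by rewrite divr_gt0.
(* Adding 1 keeps the denominator positive when [M] is 0. *)
pose d := e / 2 / (M + 1); have d0 : 0 < d.
  by rewrite !divr_gt0// ltr_wpDl.
move/cvgrPdist_le : stepcvg => /(_ d d0)[k _ /(_ k (leqnn k))].
rewrite /= sub0r normrN => kd.
have := @weak_cvg_step (c k) K k (fun m => pK _).
move=> /cvgrPdist_le/(_ (e / 2) e2).
apply: filterS => n; rewrite !sub0r !normrN -/(h k) => nk.
set s := fun t => c k (ceil_idx t (h k)) in nk kd *.
have bfp := bmeasM (bf n) bp; have bfs := bmeasM (bf n) (bs k).
have bps := bmeasB bp (bs k).
have -> : itg (fun t => f n t * p t) 0 T =
    itg (fun t => f n t * (p t - s t)) 0 T + itg (fun t => f n t * s t) 0 T.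
  rewrite -itgD//; last exact: bmeasM.
  by apply: eq_itg => x _; rewrite -mulrDr subrK.
rewrite (le_trans (ler_normD _ _))// [leRHS](splitr e) lerD//.
rewrite (le_trans (itg_norm _ _ (bmeasM (bf n) bps)))//.
apply: (@le_trans _ _ (itg (fun x => M * `|p x - s x|) 0 T)).
  apply: itg_le => [||x _]; [exact/bmeas_norm/bmeasM|exact/bmeasZ/bmeas_norm|].
  by rewrite normrM ler_wpM2r.
rewrite itgZ; last exact: bmeas_norm.
have := le_trans (ler_norm _) kd; rewrite /d ler_pdivlMr ?ltr_wpDl// => H.
apply: le_trans H; rewrite mulrC ler_wpM2l// ?lerDl//.
by apply: Rintegral_ge0.
Unshelve. all: by end_near. Qed.

(** Density of continuous functions in L^1. Integrable test functions serve both weak topologies,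
    since L^2 lies in L^1 on a bounded interval. *)
Lemma weak_cvg_integrable (phi : R -> R) : mu.-integrable `[0, T] (EFin \o phi) ->
  (fun n => \int[mu]_(t in `[0, T]) (f n t * phi t)) @ \oo --> 0.
Proof.
move=> iphi.
have mT : measurable (`[0, T]%classic : set R) by exact: measurable_itv.
have muT : (mu `[0%R, T] < +oo)%E by rewrite mu_itvcc ltry.
have M0 : 0 <= M := le_trans (normr_ge0 _) (fM 0 0).
have ifM n g := @bmeasM_integrable _ `[0, T]%classic (f n) g mT (bf n).
apply/cvgrPdist_le => e e0.
have [g [cg ig]] := approximation_continuous_integrable mT muT iphi.
have e2 : 0 < e / 2 by rewrite divr_gt0.
pose d := e / 2 / (M + 1); have d0 : 0 < d by rewrite !divr_gt0// ltr_wpDl.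
move=> /fine_cvgP[_] /cvgrPdist_le/(_ d d0)[k _ /(_ k (leqnn k))].
rewrite /= sub0r normrN => kd.
have ipg : mu.-integrable `[0, T] (EFin \o (fun t => phi t - g k t)).
  by apply: (@integrableB _ _ _ mu _ mT (EFin \o phi) (EFin \o g k)).
have {}kd : \int[mu]_(t in `[0, T]) `|phi t - g k t| <= d.
  exact: le_trans (ler_norm _) kd.
have := weak_cvg_continuous (cg k).
move=> /cvgrPdist_le/(_ (e / 2) e2).
apply: filterS => n; rewrite !sub0r !normrN => nk.
have {}nk : `|\int[mu]_(t in `[0, T]) (f n t * g k t)| <= e / 2.
  rewrite (_ : Rintegral _ _ _ =
    itg (fun t => f n t * g k (Num.max 0 (Num.min T t))) 0 T)//.
  by apply: eq_itg => x /andP[x0 xT]; rewrite min_r// max_r.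
have -> : \int[mu]_(t in `[0, T]) (f n t * phi t) =
    \int[mu]_(t in `[0, T]) (f n t * (phi t - g k t)) +
    \int[mu]_(t in `[0, T]) (f n t * g k t).
  rewrite -RintegralD//; [|exact: ifM|exact: ifM].
  by apply: eq_Rintegral => x _; rewrite -mulrDr subrK.
rewrite (le_trans (ler_normD _ _))// [leRHS](splitr e) lerD//.
have ifpg := ifM n _ ipg.
rewrite (le_trans (@le_normr_Rintegral _ _ _ mu _ _ mT ifpg))//.
have inorm : mu.-integrable `[0, T] (EFin \o (fun t => `|phi t - g k t|)).
  exact: (@integrable_norm _ _ _ mu _ _ ipg).
apply: (@le_trans _ _ (\int[mu]_(x in `[0, T]) (M * `|phi x - g k x|))).
  apply: le_Rintegral => //.
  - exact: (@integrable_norm _ _ _ mu _ _ ifpg).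
  - by apply: bmeasM_integrable => //; exact: bmeas_cst.
  - by move=> x _; rewrite normrM ler_wpM2r.
rewrite RintegralZl//.
move: kd; rewrite /d ler_pdivlMr ?ltr_wpDl// => H.
apply: le_trans H; rewrite mulrC ler_wpM2l// ?lerDl//.
by apply: Rintegral_ge0.
Qed.

End WeakConvergence.

(** * The graph Laplacian and the semi-discrete scheme *)

Section Graph.
Variables (R : realType) (V : finType) (w : V -> V -> R) (r : R).
Hypothesis wG : weighted_graph w.

(** Normalised vertex weights: [mean] is the average with respect to them, except where the
    normaliser vanishes. *)
Definition mwt (i : V) : R := deg w i `^ r / \sum_j deg w j `^ r.

Lemma meanE u : mean w r u = \sum_i mwt i * u i.
Proof.
rewrite /mean /mass /ipV mulr_suml; apply: eq_bigr => i _.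
rewrite /mwt mulr1 -mulrA mulrC; congr (_ / _ * _).
by apply: eq_bigr => j _; rewrite !mul1r.
Qed.

Lemma deg_ge0 i : 0 <= deg w i.
Proof. by case: wG => _ [w0 _]; apply: sumr_ge0. Qed.

(** A path leaving a vertex of degree 0 would need a positive weight on its first edge, so
    connectedness leaves no other vertex. *)
Lemma isolated_vertex i : deg w i = 0 -> forall j, j = i.
Proof.
move=> di j; have [_ [w0 [_ conn]]] := wG.
have wi k : w i k = 0 by have /psumr_eq0P := di; apply.
have /connectP[[|k p] /= path_p ->] := conn i j => //.
by move: path_p; rewrite wi ltxx.
Qed.

Lemma deg_gt0P : (forall i, 0 < deg w i) \/ exists i : V, deg w i = 0.
Proof.
have [H|] := pselect (exists i : V, deg w i = 0); first by right.
by move=> /forallNP H; left => i; rewrite lt_neqAle deg_ge0 eq_sym andbT; apply/eqP/H.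
Qed.

(* All weights vanish when the graph is a single vertex and [r != 0]: then
   [deg = 0], and [mean] is identically 0 because division by 0 yields 0. *)
Lemma mwt_dichotomy :
  ((forall i, 0 < mwt i) /\ ((exists i : V, true) -> \sum_i mwt i = 1)) \/
  (forall i, mwt i = 0).
Proof.
have pos : (forall i, 0 < deg w i `^ r) ->
    (forall i, 0 < mwt i) /\ ((exists i : V, true) -> \sum_i mwt i = 1).
  move=> D0; have S0 (i : V) : 0 < \sum_j deg w j `^ r.
    by rewrite (bigD1 i)//= ltr_pwDl// sumr_ge0// => j _; exact: powR_ge0.
  split=> [i|[i _]]; first by rewrite divr_gt0// S0.
  by rewrite -mulr_suml divff// gt_eqF// S0.
have [dp|[i di]] := deg_gt0P; first by left; apply: pos => i; exact: powR_gt0.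
have [D0|D0] := eqVneq (deg w i `^ r) 0.
  by right => j; rewrite (isolated_vertex di j) /mwt D0 mul0r.
left; apply: pos => j; rewrite (isolated_vertex di j).
by rewrite lt_neqAle eq_sym D0 powR_ge0.
Qed.

(** The factors deg^r and deg^(-r) cancel, and symmetry of the weights makes the double sum vanish.
    At degree 0 the powers need not cancel, but then there is a single vertex and every difference
    is 0. *)
Lemma mean_lap u : mean w r (lap w r u) = 0.
Proof.
have [dp|[i di]] := deg_gt0P; last first.
  rewrite meanE big1// => j _; rewrite /lap big1 ?mulr0// => k _.
  by rewrite (isolated_vertex di j) (isolated_vertex di k) subrr mulr0.
rewrite /mean /mass /ipV; apply/eqP; rewrite mulf_eq0; apply/orP; left; apply/eqP.
rewrite (eq_bigr (fun i => \sum_j w i j * u i - \sum_j w i j * u j)); last first.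
  move=> i _; rewrite mulr1 /lap mulrAC -sumrB.
  rewrite powRN mulVf ?gt_eqF ?powR_gt0// mul1r.
  by apply: eq_bigr => j _; rewrite mulrBr.
rewrite sumrB exchange_big/=; apply/eqP; rewrite subr_eq0; apply/eqP.
apply: eq_bigr => i _; apply: eq_bigr => j _.
by case: wG => ->.
Qed.

Lemma lapE u i : lap w r u i = \sum_j (deg w i `^ (- r) * ((i == j)%:R * deg w i - w i j)) * u j.
Proof.
rewrite /lap mulr_sumr; under [RHS]eq_bigr do rewrite -mulrA mulrBl mulrBr.
under [LHS]eq_bigr do rewrite mulrBr mulrBr.
rewrite !sumrB; congr (_ - _).
rewrite [RHS](bigD1 i)//= eqxx mul1r [X in _ = _ + X]big1 ?addr0.
  by rewrite -mulr_sumr -mulr_suml.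
by move=> j ji; rewrite eq_sym (negbTE ji) !mul0r mulr0.
Qed.

(** The sum of the absolute values of all matrix entries, a crude bound for the operator norm in the
    maximum norm. *)
Definition lap_bd : R :=
  \sum_i \sum_j `|deg w i `^ (- r) * ((i == j)%:R * deg w i - w i j)|.

Lemma lap_bd_ge0 : 0 <= lap_bd.
Proof. by apply: sumr_ge0 => i _; exact: sumr_ge0. Qed.

Lemma lap_bound u K i : (forall j, `|u j| <= K) -> `|lap w r u i| <= lap_bd * K.
Proof.
move=> uK; have K0 : 0 <= K := le_trans (normr_ge0 _) (uK i).
rewrite lapE (le_trans (ler_norm_sum _ _ _))//.
rewrite /lap_bd [in leRHS](bigD1 i)//= mulrDl ler_wpDr//.
  by rewrite mulr_ge0// sumr_ge0// => j _; exact: sumr_ge0.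
rewrite mulr_suml; apply: ler_sum => j _.
by rewrite normrM ler_wpM2l.
Qed.

Lemma lapB u v i : lap w r (fun j => u j - v j) i = lap w r u i - lap w r v i.
Proof. by rewrite !lapE -sumrB; apply: eq_bigr => j _; rewrite mulrBr. Qed.

Lemma iter_lap_bound u k i : in01 u -> `|iter k (lap w r) u i| <= lap_bd ^+ k.
Proof.
move=> u01; elim: k i => [|k IH] i /=.
  by have /andP[u0 u1] := u01 i; rewrite ger0_norm.
by rewrite exprS; exact: lap_bound.
Qed.

Definition heat_sum (t : R) (u : V -> R) (N : nat) (i : V) : R :=
  \sum_(k < N) ((- t) ^+ k / (k`!)%:R * iter k (lap w r) u i).

Lemma heat_term_bound t u k i : in01 u -> 0 <= t ->
  `|(- t) ^+ k / (k`!)%:R * iter k (lap w r) u i| <= exp_coeff (t * lap_bd) k.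
Proof.
move=> u01 t0; rewrite /exp_coeff/= normrM normrM normrX normrN (ger0_norm t0).
rewrite ger0_norm ?invr_ge0// exprMn mulrAC ler_wpM2r ?invr_ge0//.
by rewrite ler_wpM2l ?exprn_ge0// iter_lap_bound.
Qed.

(** [heat] is defined by [limn], which is informative only once convergence is proved; the
    exponential series of t times [lap_bd] dominates the terms. *)
Lemma heat_cvg t u i : in01 u -> 0 <= t ->
  (fun N => heat_sum t u N i) @ \oo --> heat w r t u i.
Proof.
move=> u01 t0; rewrite /heat -/(heat_sum t u).
suff : cvgn (fun N => heat_sum t u N i) by [].
have -> : (fun N => heat_sum t u N i) =
    series (fun k => (- t) ^+ k / (k`!)%:R * iter k (lap w r) u i).
  by apply/funext => N; rewrite /heat_sum /series/= big_mkord.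
apply: normed_cvg; apply: (@series_le_cvg _ _ (exp_coeff (t * lap_bd))) => [n|n|n|].
- exact: normr_ge0.
- by apply: exp_coeff_ge0; rewrite mulr_ge0// lap_bd_ge0.
- exact: heat_term_bound.
- exact: is_cvg_series_exp_coeff.
Qed.

(** Every term beyond the zeroth is a multiple of a Laplacian and has mean 0, so all nonempty
    partial sums have the mean of [u]. *)
Lemma heat_mean t u : in01 u -> 0 <= t -> mean w r (heat w r t u) = mean w r u.
Proof.
move=> u01 t0.
have H : (fun N => mean w r (heat_sum t u N)) @ \oo --> mean w r (heat w r t u).
  rewrite meanE; under eq_fun do rewrite meanE.
  by apply: cvg_sumr => i; apply: cvgM; [exact: cvg_cst|exact: heat_cvg].
have E N : mean w r (heat_sum t u N.+1) = mean w r u.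
  rewrite !meanE /heat_sum.
  under eq_bigr do rewrite big_ord_recl/= expr0 fact0 divr1 mul1r mulrDr mulr_sumr.
  rewrite big_split/= exchange_big/= [X in _ + X]big1 ?addr0// => k _.
  have := mean_lap (iter k (lap w r) u); rewrite meanE => /(congr1 (fun x =>
    ((- t) ^+ (bump 0 k) / ((bump 0 k)`!)%:R) * x)).
  rewrite mulr0 mulr_sumr => E; rewrite -[RHS]E; apply: eq_bigr => i _.
  by rewrite mulrCA.
have H' : (fun N => mean w r (heat_sum t u N)) @ \oo --> mean w r u.
  by rewrite -cvg_shiftS /=; under eq_fun do rewrite E; exact: cvg_cst.
exact: (cvg_unique _ H H').
Qed.

(** Removing the terms of order 0 and 1 and using k! <= (k+2)! leaves at most (tA)^2 exp(tA), with A
    = [lap_bd]; bounding exp(tA) by exp(TA) makes [C] independent of t. *)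
Lemma heat_approx (T : R) : exists C, 0 <= C /\ forall t u i, in01 u -> 0 <= t <= T ->
  `|heat w r t u i - u i + t * lap w r u i| <= C * t ^+ 2.
Proof.
exists (lap_bd ^+ 2 * expR (T * lap_bd)); split.
  by rewrite mulr_ge0 ?expR_ge0// sqr_ge0.
move=> t u i u01 /andP[t0 tT]; have A0 := lap_bd_ge0.
have tA : 0 <= t * lap_bd by rewrite mulr_ge0.
have H : (fun N => `|heat_sum t u N i - u i + t * lap w r u i|) @ \oo -->
    `|heat w r t u i - u i + t * lap w r u i|.
  by apply: cvg_norm; apply: cvgD; [apply: cvgB; [exact: heat_cvg|]|]; exact: cvg_cst.
apply: (cvgr_to_le H); exists 2 => // -[|[|N]]//= _.
rewrite /heat_sum !big_ord_recl/= /bump/= expr0 fact0 divr1 mul1r expr1 (_ : (1`!)%N = 1%N)// divr1.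
rewrite (_ : _ + _ = \sum_(k < N) ((- t) ^+ k.+2 / (k.+2)`!%:R * iter k.+2 (lap w r) u i)).
  2: by rewrite mulNr; ring.
rewrite (le_trans (ler_norm_sum _ _ _))//.
apply: (@le_trans _ _ (\sum_(k < N) (t * lap_bd) ^+ 2 * exp_coeff (t * lap_bd) k)).
  apply: ler_sum => k _; rewrite (le_trans (heat_term_bound _ _ u01 t0))//.
  rewrite /exp_coeff/= -[k.+2]add2n exprD -mulrA ler_wpM2l ?sqr_ge0//.
  rewrite ler_wpM2l ?exprn_ge0//.
  rewrite lef_pV2 ?posrE ?ltr0n ?fact_gt0// ler_nat.
  by rewrite !factS mulnA leq_pmull.
rewrite -mulr_sumr (_ : _ * t ^+ 2 = (t * lap_bd) ^+ 2 * expR (T * lap_bd)); last by ring.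
rewrite ler_wpM2l ?sqr_ge0//.
apply: (@le_trans _ _ (expR (t * lap_bd))); last by rewrite ler_expR ler_wpM2r.
have nd : nondecreasing_seq (series (exp_coeff (t * lap_bd))).
  by apply/nondecreasing_seqP => n; rewrite seriesSr lerDl exp_coeff_ge0.
have := nondecreasing_cvgn_le nd (is_cvg_series_exp_coeff (t * lap_bd)) N.
by rewrite /series/= big_mkord.
Qed.

(** The time derivative as solved from the flow equation. *)
Definition flow_rhs (eps : R) (u b : V -> R) (i : V) : R :=
  - lap w r u i + (u i - mean w r u + (b i - mean w r b)) / eps.

(** The coefficients of [flow_rhs] in [b], and below in [u]. Linearity lets it pass through
    integrals and limits coordinate by coordinate. *)
Definition flow_bcoef (eps : R) (i j : V) : R := ((i == j)%:R - mwt j) / eps.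

Definition flow_ucoef (eps : R) (i j : V) : R :=
  flow_bcoef eps i j - deg w i `^ (- r) * ((i == j)%:R * deg w i - w i j).

Lemma flow_rhsE eps u b i : flow_rhs eps u b i =
  \sum_j flow_ucoef eps i j * u j + \sum_j flow_bcoef eps i j * b j.
Proof.
have dev v : (v i - mean w r v) / eps = \sum_j flow_bcoef eps i j * v j.
  rewrite /flow_bcoef; under eq_bigr do rewrite mulrAC mulrBl.
  rewrite -mulr_suml sumrB meanE; congr ((_ - _) / _).
  rewrite (bigD1 i)//= eqxx mul1r big1 ?addr0// => j ji.
  by rewrite eq_sym (negbTE ji) mul0r.
rewrite /flow_rhs mulrDl addrA !dev lapE -sumrN -big_split/=; congr (_ + _).
by apply: eq_bigr => j _; rewrite /flow_ucoef; ring.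
Qed.

Lemma mean_itv u : in01 u -> 0 <= mean w r u <= 1.
Proof.
move=> u01; rewrite meanE; have [[p0 p1]|p0] := mwt_dichotomy; last first.
  by rewrite big1 ?lexx ?ler01// => i _; rewrite p0 mul0r.
have [[i _]|nV] := pselect (exists i : V, true); last first.
  by rewrite big1 ?lexx ?ler01// => i _; case: nV; exists i.
rewrite sumr_ge0/=; last by move=> j _; rewrite mulr_ge0 ?(ltW (p0 _))//; case/andP: (u01 j).
rewrite -(p1 (ex_intro _ i isT)); apply: ler_sum => j _.
by rewrite ler_piMr ?(ltW (p0 _))//; case/andP: (u01 j).
Qed.

(** * Uniform estimates for the semi-discrete iterates *)

Section Scheme.
Variables (eps : R) (u0 : V -> R).
Hypotheses (eps0 : 0 < eps) (u01 : in01 u0).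
Hypotheses (u0n0 : u0 <> (fun=> 0)) (u0n1 : u0 <> (fun=> 1)).

Lemma semi_discrete_in01 t u b m : semi_discrete w r eps t u0 u b -> in01 (u m).
Proof. by move=> [u_0 H]; case: m => [|m]; [rewrite u_0|case: (H m) => -[]]. Qed.

Lemma mean_cst c : (exists i : V, mwt i != 0) -> mean w r (fun=> c) = c.
Proof.
move=> [i pi]; have [[_ p1]|p0] := mwt_dichotomy; last by rewrite p0 eqxx in pi.
by rewrite meanE -mulr_suml p1 ?mul1r//; exists i.
Qed.

(** Averaging the scheme kills both terms of the form v - mean v, because the weights sum to 1, and
    the heat step preserves the mean. If all weights vanish, both sides are 0. *)
Lemma semi_discrete_mean t u b m : 0 < t -> semi_discrete w r eps t u0 u b ->
  mean w r (u m) = mean w r u0.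
Proof.
move=> t0 sd; have [u_0 H] := sd; elim: m => [|m <-]; first by rewrite u_0.
have [_ {}H] := H m; have t01 := @semi_discrete_in01 _ _ _ m sd.
rewrite -(heat_mean t01 (ltW t0)).
have [[i pi]|p0] := pselect (exists i : V, mwt i != 0); last first.
  by rewrite !meanE !big1// => i _; rewrite (_ : mwt i = 0) ?mul0r//;
    apply/eqP/negPn/negP => pi; apply: p0; exists i.
have p1 : \sum_i mwt i = 1 by have := mean_cst 1 (ex_intro _ i pi); rewrite meanE -mulr_suml mulr1.
set c := mean w r (u m.+1) in H *; set d := mean w r (b m.+1) in H.
have : \sum_i mwt i * (u m.+1 i - heat w r t (u m) i - t / eps * u m.+1 i + t / eps * c) =
       \sum_i mwt i * (t / eps * b m.+1 i - t / eps * d).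
  by apply: eq_bigr => j _; rewrite H.
have -> : \sum_i mwt i * (t / eps * b m.+1 i - t / eps * d) =
    t / eps * d - (\sum_i mwt i) * (t / eps * d).
  by rewrite /d meanE mulr_sumr mulr_suml -sumrB; apply: eq_bigr => j _; ring.
have -> : \sum_i mwt i * (u m.+1 i - heat w r t (u m) i - t / eps * u m.+1 i + t / eps * c) =
    c - mean w r (heat w r t (u m)) - t / eps * c + (\sum_i mwt i) * (t / eps * c).
  transitivity (\sum_i mwt i * u m.+1 i - \sum_i mwt i * heat w r t (u m) i -
      t / eps * (\sum_i mwt i * u m.+1 i) + (\sum_i mwt i) * (t / eps * c)).
    rewrite mulr_suml mulr_sumr -!sumrB -big_split/=.
    by apply: eq_bigr => j _; ring.
  by rewrite -!meanE.
by rewrite p1 => E; apply/eqP; rewrite -subr_eq0; apply/eqP; lra.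
Qed.

Lemma mwt_ge0 i : 0 <= mwt i.
Proof. by have [[p0 _]|->] := mwt_dichotomy; first exact: ltW. Qed.

(* A contact value exceeds the mean [c] of [beta] by at most [K], and mass
   conservation keeps the mean [rho] of [u] away from 0 and 1; averaging
   [beta <= (c + K) (1 - u)] when [c >= 0], resp. [beta >= (c - K) u] when
   [c <= 0], then bounds [c]. *)
Lemma mean_beta_bound (K : R) : 0 <= K -> exists K', forall u b, inB u b ->
  mean w r u = mean w r u0 ->
  (forall i, u i = 0 -> b i - mean w r b <= K) ->
  (forall i, u i = 1 -> - K <= b i - mean w r b) -> `|mean w r b| <= K'.
Proof.
move=> K0; have [[p0 p1']|p0] := mwt_dichotomy; last first.
  by exists 0 => u b _ _ _ _; rewrite meanE big1 ?normr0// => i _; rewrite p0 mul0r.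
(* A vertex where [u0] is not 0 and one where it is not 1 make [rho] strictly interior. *)
have [i0 ui0] : exists i, u0 i != 0.
  apply: contra_notP u0n0 => /forallNP H; apply/funext => i; apply/eqP/negPn/negP; exact: H.
have [i1 ui1] : exists i, u0 i != 1.
  apply: contra_notP u0n1 => /forallNP H; apply/funext => i; apply/eqP/negPn/negP; exact: H.
have p1 := p1' (ex_intro _ i0 isT).
set rho := mean w r u0.
have rho0 : 0 < rho.
  rewrite /rho meanE (bigD1 i0)//= ltr_pwDl//.
    by rewrite mulr_gt0// lt_neqAle eq_sym ui0; case/andP: (u01 i0).
  by apply: sumr_ge0 => j _; rewrite mulr_ge0 ?mwt_ge0//; case/andP: (u01 j).
have rho1 : rho < 1.
  rewrite -subr_gt0 -{1}p1 /rho meanE -sumrB (bigD1 i1)//= ltr_pwDl//.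
    rewrite -[X in X - _]mulr1 -mulrBr mulr_gt0// subr_gt0 lt_neqAle ui1.
    by case/andP: (u01 i1).
  apply: sumr_ge0 => j _; rewrite -[X in X - _]mulr1 -mulrBr mulr_ge0 ?mwt_ge0//.
  by rewrite subr_ge0; case/andP: (u01 j).
(* The case c >= 0 yields c rho <= K (1 - rho), the other -c (1 - rho) <= K rho; the sum of the two
   bounds replaces a maximum. *)
exists (K / rho + K / (1 - rho)) => u b [ui bi] mu0 b0 b1.
have a1 : 0 <= K / rho by rewrite divr_ge0// ltW.
have a2 : 0 <= K / (1 - rho) by rewrite divr_ge0// subr_ge0 ltW.
set c := mean w r b in b0 b1 *.
have [c0|c0] := leP 0 c.
  have ub i : b i <= (c + K) * (1 - u i).
    have [B0 [Bm B1]] := bi i; have /andP[ui_ge0 ui_le1] := ui i.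
    have [u_0|u_0] := eqVneq (u i) 0; first by rewrite u_0 subr0 mulr1 -lerBlDl b0.
    have [u_1|u_1] := eqVneq (u i) 1; first by rewrite u_1 subrr mulr0 B1.
    have -> : b i = 0 by apply: Bm; rewrite !lt_neqAle u_1 eq_sym u_0 ui_ge0.
    by apply: mulr_ge0; [exact: addr_ge0|rewrite subr_ge0].
  have : c <= (c + K) * (1 - rho).
    rewrite {1}/c meanE -mu0 meanE -p1 -sumrB mulr_sumr; apply: ler_sum => i _.
    have := ler_wpM2l (mwt_ge0 i) (ub i); move=> /le_trans; apply.
    by rewrite le_eqVlt; apply/orP; left; apply/eqP; ring.
  rewrite ger0_norm// => H.
  have : c <= K / rho.
    by rewrite ler_pdivlMr//; have : 0 <= rho * K; [rewrite mulr_ge0// ltW|nra].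
  by move=> /le_trans; apply; rewrite lerDl.
have lb i : (c - K) * u i <= b i.
  have [B0 [Bm B1]] := bi i; have /andP[ui_ge0 ui_le1] := ui i.
  have [u_0|u_0] := eqVneq (u i) 0; first by rewrite u_0 mulr0 B0.
  have [u_1|u_1] := eqVneq (u i) 1; first by rewrite u_1 mulr1; have := b1 i u_1; lra.
  have -> : b i = 0 by apply: Bm; rewrite !lt_neqAle u_1 eq_sym u_0 ui_ge0.
  by rewrite mulr_le0_ge0// subr_le0 (le_trans (ltW c0)).
have : (c - K) * rho <= c.
  rewrite {2}/c meanE -mu0 meanE mulr_sumr; apply: ler_sum => i _.
  have := ler_wpM2l (mwt_ge0 i) (lb i); apply: le_trans.
  by rewrite le_eqVlt; apply/orP; left; apply/eqP; ring.
rewrite ltr0_norm// => H.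
have : - c <= K / (1 - rho).
  rewrite ler_pdivlMr ?subr_gt0//.
  by have : 0 <= (1 - rho) * K; [rewrite mulr_ge0// subr_ge0 ltW|nra].
by move=> /le_trans; apply; rewrite lerDr.
Qed.

(** Heat moves a state by at most D t; this bounds beta minus its mean at contact points, then the
    mean, then beta, then the increments. The last estimate is the heat error plus the cost of
    evaluating the Laplacian at [u m.+1] instead of [u m]. *)
Lemma discrete_estimates : exists M, 0 <= M /\ forall t u b, 0 < t < eps ->
  semi_discrete w r eps t u0 u b -> forall m i,
  [/\ `|b m.+1 i| <= M, `|u m.+1 i - u m i| <= M * t &
    `|u m.+1 i - u m i - t * flow_rhs eps (u m.+1) (b m.+1) i| <= M * t ^+ 2].
Proof.
have [C [C0 HC]] := heat_approx eps.
have A0 := lap_bd_ge0.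
pose D := lap_bd + C * eps.
have D0 : 0 <= D by rewrite addr_ge0// mulr_ge0// ltW.
(* At u = 0 the scheme times eps gives t (beta - mean) <= eps D t + t, since the mean of [u] is at
   most 1; the bound at u = 1 is symmetric. *)
pose K := eps * D + 1; have K0 : 0 <= K by rewrite addr_ge0// mulr_ge0// ltW.
have [K' HK'] := mean_beta_bound K0.
have N0 : 0 <= K + `|K'| by rewrite addr_ge0.
(* [D] comes from the heat step; the quotient bounds the remaining drift [g]. *)
pose L := D + (2 + K + `|K'| + `|K'|) / eps.
have L0 : 0 <= L.
  by rewrite addr_ge0// divr_ge0 ?(ltW eps0)//; have := normr_ge0 K'; lra.
have LM : 0 <= C + lap_bd * L by apply: addr_ge0 => //; exact: mulr_ge0.
have NL : 0 <= K + `|K'| + L by exact: addr_ge0.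
exists (K + `|K'| + L + (C + lap_bd * L)); split; first exact: addr_ge0.
move=> t u b /andP[t0 te] sd m.
have [_ H] := sd; have [B eqn] := H m => {H}; have [ui bi] := B.
have um := @semi_discrete_in01 t u b m sd.
have mE := semi_discrete_mean m.+1 t0 sd.
have /andP[mu_ge0 mu_le1] := mean_itv ui.
have ttC : C * t ^+ 2 <= C * eps * t.
  by rewrite expr2 mulrA ler_wpM2r ?(ltW t0)// ler_wpM2l// ltW.
have heatD i : `|heat w r t (u m) i - u m i| <= D * t.
  have h1 := HC t (u m) i um; rewrite (ltW t0) (ltW te) in h1.
  have h2 : `|lap w r (u m) i| <= lap_bd.
    rewrite -[leRHS]mulr1; apply: lap_bound => j.
    by have /andP[? ?] := um j; rewrite ger0_norm.
  have -> : heat w r t (u m) i - u m i =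
    (heat w r t (u m) i - u m i + t * lap w r (u m) i) - t * lap w r (u m) i by ring.
  rewrite (le_trans (ler_normB _ _))// normrM (gtr0_norm t0).
  rewrite (_ : D * t = C * eps * t + t * lap_bd); last by rewrite /D; ring.
  by rewrite lerD// ?(le_trans (h1 isT))// ler_wpM2l// ltW.
set c := mean w r (b m.+1) in eqn *; set d := mean w r (u m.+1) in eqn mu_ge0 mu_le1 *.
have eqnt i : (u m.+1 i - heat w r t (u m) i) * eps - t * u m.+1 i + t * d =
    t * (b m.+1 i - c).
  have te' : t / eps * eps = t by rewrite divfK ?gt_eqF.
  have := congr1 (fun x => x * eps) (eqn i); rewrite -/c -/d => E.
  rewrite -{2 3 4}te'; transitivity ((t / eps * b m.+1 i - t / eps * c) * eps); last by ring.
  by rewrite -E; ring.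
have h0 i : u m.+1 i = 0 -> b m.+1 i - c <= K.
  move=> u_0; rewrite -(ler_pM2l t0) -eqnt u_0.
  have := heatD i; rewrite ler_norml => /andP[h1 h2].
  have /andP[v0 v1] := um i.
  have : 0 <= eps * (heat w r t (u m) i + D * t) by apply: mulr_ge0; [exact: ltW|lra].
  have : t * d <= t by rewrite ler_piMr// ltW.
  rewrite /K; nra.
have h1 i : u m.+1 i = 1 -> - K <= b m.+1 i - c.
  move=> u_1; rewrite -(ler_pM2l t0) -eqnt u_1.
  have := heatD i; rewrite ler_norml => /andP[h1 h2].
  have /andP[v0 v1] := um i.
  have : 0 <= eps * (1 - heat w r t (u m) i + D * t) by apply: mulr_ge0; [exact: ltW|lra].
  have : 0 <= t * d by rewrite mulr_ge0// ltW.
  rewrite /K; nra.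
have cK : `|c| <= `|K'| := le_trans (HK' _ _ B mE h0 h1) (ler_norm _).
have bK i : `|b m.+1 i| <= K + `|K'|.
  have := cK; rewrite ler_norml => /andP[c1 c2].
  have [B0 [Bm B1]] := bi i; have /andP[v0 v1] := ui i.
  have [u_0|u_0] := eqVneq (u m.+1 i) 0.
    by rewrite ger0_norm ?B0//; have := h0 i u_0; lra.
  have [u_1|u_1] := eqVneq (u m.+1 i) 1.
    by rewrite ler0_norm ?B1//; have := h1 i u_1; lra.
  have -> : b m.+1 i = 0 by apply: Bm; rewrite !lt_neqAle u_1 eq_sym u_0 v0.
  by rewrite normr0.
pose g i := (u m.+1 i - d + (b m.+1 i - c)) / eps.
have stepE i : u m.+1 i - u m i = heat w r t (u m) i - u m i + t * g i.
  have := eqnt i; rewrite /g => E.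
  have -> : u m.+1 i - d + (b m.+1 i - c) = (u m.+1 i - heat w r t (u m) i) * eps / t.
    by apply: (mulfI (lt0r_neq0 t0)); rewrite mulrDr -E; field; rewrite gt_eqF.
  by field; rewrite !gt_eqF.
have uL i : `|u m.+1 i - u m i| <= L * t.
  rewrite stepE (le_trans (ler_normD _ _))// /L mulrDl lerD// normrM (gtr0_norm t0).
  rewrite mulrC ler_wpM2r ?(ltW t0)// /g normrM [X in _ * X]gtr0_norm ?invr_gt0//.
  rewrite ler_wpM2r ?invr_ge0 ?(ltW eps0)//.
  have := bK i; have := cK; rewrite !ler_norml => /andP[c1 c2] /andP[x1 x2].
  have /andP[v0 v1] := ui i.
  by apply/andP; split; lra.
move=> i; split.
- by rewrite (le_trans (bK i))// -[leRHS]addrA lerDl; exact: addr_ge0.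
- rewrite (le_trans (uL i))// ler_wpM2r ?(ltW t0)// addrAC lerDr; exact: addr_ge0.
have -> : u m.+1 i - u m i - t * flow_rhs eps (u m.+1) (b m.+1) i =
    (heat w r t (u m) i - u m i + t * lap w r (u m) i) +
    t * lap w r (fun j => u m.+1 j - u m j) i.
  by rewrite lapB /flow_rhs -/c -/d stepE /g; ring.
rewrite (le_trans (ler_normD _ _))// normrM (gtr0_norm t0).
apply: (@le_trans _ _ ((C + lap_bd * L) * t ^+ 2)); last first.
  by rewrite ler_wpM2r ?sqr_ge0// lerDr.
rewrite mulrDl lerD//; first by apply: HC; rewrite // (ltW t0) (ltW te).
rewrite (_ : _ * t ^+ 2 = t * (lap_bd * (L * t))); last by ring.
by rewrite ler_wpM2l ?(ltW t0)//; exact: lap_bound.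
Qed.

End Scheme.

End Graph.

(** * Primitives and weak derivatives *)

Section TimeIntegral.
Variable R : realType.
Notation mu := (@lebesgue_measure R).

(** The index m at time t satisfies m h < t + h, so the m local errors k h^2 add up to at most k h
    (t + h); the part of the last cell beyond t adds K h. *)
Lemma itg_step_approx (h : R) (s c : nat -> R) (k K t : R) : 0 < h -> 0 <= k -> 0 <= t ->
  (forall m, `|s m.+1 - s m - h * c m.+1| <= k * h ^+ 2) -> (forall m, `|c m| <= K) ->
  `|s (ceil_idx t h) - s 0%N - itg (fun x => c (ceil_idx x h)) 0 t| <= k * h * (t + h) + K * h.
Proof.
move=> h0 k0 t0 sc cK; have bc := bmeas_step h0 cK.
have K0 : 0 <= K := le_trans (normr_ge0 _) (cK 0%N).
have /andP[tm mt] := ceil_idx_bounds h0 t0; set m := ceil_idx t h in tm mt *.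
have itgm : itg (fun x => c (ceil_idx x h)) 0 (m%:R * h) = \sum_(j < m) h * c j.+1.
  rewrite (@eq_itg _ _ (fun x => 1 * c (ceil_idx x h))); last by move=> x _; rewrite mul1r.
  rewrite (itg_mul_step h0 m (bmeas_cst 1) cK); apply: eq_bigr => j _.
  rewrite itg_cst ?ler_wpM2r ?ler_nat ?(ltW h0)// mul1r mulrC -mulrBl.
  by rewrite -natr1 addrAC subrr add0r mul1r.
have sm : `|s m - s 0%N - \sum_(j < m) h * c j.+1| <= m%:R * (k * h ^+ 2).
  elim: m {tm mt itgm} => [|m IH]; first by rewrite subrr big_ord0 subrr normr0 mul0r.
  rewrite big_ord_recr/= -natr1 mulrDl mul1r.
  rewrite (_ : s m.+1 - _ - _ = (s m - s 0%N - \sum_(j < m) h * c j.+1) +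
    (s m.+1 - s m - h * c m.+1)); last by ring.
  by rewrite (le_trans (ler_normD _ _))// lerD.
have tail : `|itg (fun x => c (ceil_idx x h)) t (m%:R * h)| <= K * h.
  rewrite (le_trans (itg_bound bc tm (fun x _ => cK _)))// ler_wpM2l//.
  by rewrite lerBlDl ltW.
rewrite (_ : _ - itg _ _ _ = (s m - s 0%N - \sum_(j < m) h * c j.+1) +
  itg (fun x => c (ceil_idx x h)) t (m%:R * h)); last first.
  by rewrite -itgm (itg_chasles bc t0 tm); ring.
rewrite (le_trans (ler_normD _ _))// lerD// (le_trans sm)//.
rewrite (_ : _ * _ = k * h * (m%:R * h)); last by ring.
by rewrite ler_wpM2l ?mulr_ge0 ?(ltW h0)// ltW.
Qed.

(** As in the Arzela-Ascoli theorem, equicontinuity up to the vanishing error [eta] carries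
    convergence from the rational times to all times. *)
Lemma grid_cvg (F : nat -> R -> R) (L : R) (eta : nat -> R) : 0 <= L -> eta @ \oo --> 0 ->
  (forall n s t, 0 <= s -> 0 <= t -> `|F n s - F n t| <= L * `|s - t| + eta n) ->
  (forall p j : nat, cvgn (fun n => F n (j%:R / p.+1%:R))) ->
  forall t, 0 <= t -> cvgn (F ^~ t).
Proof.
move=> L0 eta0 FL Fgrid t t0; apply/cauchy_cvgP/cauchy_exP => e e0.
pose p := Num.truncn (3 * L / e).
have Lp : L / p.+1%:R < e / 3.
  rewrite ltr_pdivrMr// mulrAC ltr_pdivlMr// -ltr_pdivrMl// mulrC [L * _]mulrC.
  exact: truncnS_gt.
pose j := Num.truncn (t * p.+1%:R); pose x : R := j%:R / p.+1%:R.
have x0 : 0 <= x by rewrite divr_ge0.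
have tx : `|t - x| <= p.+1%:R^-1.
  have tp : 0 <= t * p.+1%:R by rewrite mulr_ge0.
  have /andP[j1 j2] := truncn_itv tp.
  rewrite ger0_norm ?subr_ge0 ?ler_pdivrMr// lerBlDl -[X in _ + X]mul1r -mulrDl.
  by rewrite ler_pdivlMr// natr1 ltW.
have [y Fy] : exists y : R, (fun n => F n x) @ \oo --> y.
  by have /cvg_ex[y ?] := Fgrid p j; exists y.
have e3 : 0 < e / 3 by rewrite divr_gt0.
exists y; move/cvgrPdist_lt : Fy => /(_ _ e3) Fy.
move/cvgrPdist_lt : eta0 => /(_ _ e3) eta0.
apply: filterS2 Fy eta0 => n; rewrite /= sub0r normrN => Fy en.
rewrite /ball/= -(subrKA (F n x)) (le_lt_trans (ler_normD _ _))//.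
have := FL n x t x0 t0; rewrite [`|x - t|]distrC => Fxt.
have : L * `|t - x| < e / 3 by rewrite (le_lt_trans _ Lp)// ler_wpM2l.
have := ler_norm (eta n); lra.
Qed.

(** Over N equal pieces the increments add up to at most C (b - a)^2 / N, and N is arbitrary. *)
Lemma quadratic_increment_constant (W : R -> R) (a b C : R) : a <= b ->
  (forall x y, a <= x -> x <= y -> y <= b -> `|W y - W x| <= C * (y - x) ^+ 2) ->
  W b = W a.
Proof.
move=> ab HW; apply/eqP; rewrite -subr_eq0 -normr_eq0 eq_le normr_ge0 andbT.
rewrite leNgt; apply/negP => d0; set d := `|_| in d0.
pose N := (Num.truncn (C * (b - a) ^+ 2 / d)).+1.
pose h := (b - a) / N%:R.
have h0 : 0 <= h by rewrite divr_ge0// subr_ge0.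
have Nh : N%:R * h = b - a by rewrite mulrC divfK// pnatr_eq0.
have H k : (k <= N)%N -> `|W (a + k%:R * h) - W a| <= k%:R * (C * h ^+ 2).
  elim: k => [|k IH kN]; first by rewrite !mul0r addr0 subrr normr0.
  have kh : a + k.+1%:R * h = a + k%:R * h + h by rewrite -natr1; ring.
  have k0 : a <= a + k%:R * h by rewrite lerDl mulr_ge0.
  have kb : a + k.+1%:R * h <= b.
    by rewrite -lerBrDl -Nh ler_wpM2r// ler_nat.
  rewrite -(subrKA (W (a + k%:R * h))) (le_trans (ler_normD _ _))//.
  rewrite -[in leRHS]natr1 mulrDl mul1r addrC lerD ?IH ?(ltnW kN)//.
  have := HW (a + k%:R * h) (a + k.+1%:R * h) k0 _ kb.
  have -> : a + k.+1%:R * h - (a + k%:R * h) = h by rewrite kh; ring.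
  by apply; rewrite kh lerDl.
have := H N (leqnn N); rewrite Nh (_ : a + (b - a) = b) -/d; last by ring.
have -> : N%:R * (C * h ^+ 2) = C * (b - a) ^+ 2 / N%:R.
  by rewrite /h; field; rewrite pnatr_eq0.
rewrite ler_pdivlMr// leNgt => /negP; apply.
by rewrite -ltr_pdivrMl// mulrC; exact: truncnS_gt.
Qed.

Lemma itg_derive1 (phi : R -> R) (x y : R) : x <= y ->
  (forall z, derivable phi z 1) -> continuous (derive1 phi) ->
  itg (derive1 phi) x y = phi y - phi x.
Proof.
move=> xy dphi cphi'; move: xy; rewrite le_eqVlt => /predU1P[->|xy].
  by rewrite itg_pt subrr.
have cphi : continuous phi.
  by move=> z; apply: differentiable_continuous; exact/derivable1_diffP.
rewrite /itg /Rintegral (@continuous_FTC2 _ (derive1 phi) phi x y xy); first by [].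
- exact: continuous_subspaceT.
- split; first by move=> z _.
  + exact/cvg_at_right_filter/cphi.
  + exact/cvg_at_left_filter/cphi.
- by move=> z _.
Qed.

Lemma itg_oo (f : R -> R) a b : bmeas f -> \int[mu]_(x in `]a, b[) f x = itg f a b.
Proof.
move=> bf; have ioc : mu.-integrable `]a, b] (EFin \o f).
  by apply: integrableS (bmeas_itv a b bf) => //; exact: subset_itv_oc_cc.
have ioo : mu.-integrable `]a, b[ (EFin \o f).
  by apply: integrableS (bmeas_itv a b bf) => //; exact: subset_itv_oo_cc.
by rewrite Rintegral_itv_bndo_bndc// itg_obnd.
Qed.

Lemma weak_deriv_primitive (F g : R -> R) (a b : R) : a < b -> bmeas F -> bmeas g ->
  (forall s t, a <= s -> s <= t -> t <= b -> F t - F s = itg g s t) -> weak_deriv a b F g.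
Proof.
move=> ab bF bg FE phi [dphi [c [d [ac [cd [db phi0]]]]]].
have dphi0 z : derivable phi z 1 := dphi 0%N z.
have cphi : continuous phi.
  by move=> z; apply: differentiable_continuous; exact/derivable1_diffP.
have cphi' : continuous (derive1 phi).
  by move=> z; apply: differentiable_continuous; apply/derivable1_diffP; exact: (dphi 1%N z).
pose cl t := Num.max a (Num.min b t).
have clE t : a <= t <= b -> cl t = t by move=> /andP[at_ tb]; rewrite /cl min_r// max_r.
have bp : bmeas (fun t => phi (cl t)) by apply: bmeas_clamp => //; exact: ltW.
have bp' : bmeas (fun t => derive1 phi (cl t)) by apply: bmeas_clamp => //; exact: ltW.
have phiE x y : a <= x -> x <= y -> y <= b ->
    phi y - phi x = itg (fun t => derive1 phi (cl t)) x y.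
  move=> ax xy yb; rewrite -(itg_derive1 xy dphi0 cphi'); apply: eq_itg => t /andP[xt ty].
  by rewrite clE// (le_trans ax xt) (le_trans ty yb).
have [_ [G gG]] := bg; have [_ [P pP]] := bp'.
have G0 : 0 <= G := le_trans (normr_ge0 _) (gG 0).
have P0 : 0 <= P := le_trans (normr_ge0 _) (pP 0).
have bgp := bmeasM bg bp; have bFp := bmeasM bF bp'.
(* the increments of [W] are quadratic, so [W] is constant; this replaces the
   product rule for absolutely continuous functions *)
pose W x := F x * phi x - itg (fun t => g t * phi (cl t) + F t * derive1 phi (cl t)) a x.
have Wba : W b = W a.
  apply: (@quadratic_increment_constant W a b (2 * (G * P)) (ltW ab)) => x y ax xy yb.
  have bgx : bmeas (fun t => g t * (phi x - phi (cl t))).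
    by apply: bmeasM => //; apply: bmeasB => //; exact: bmeas_cst.
  have bFy : bmeas (fun t => (F y - F t) * derive1 phi (cl t)).
    by apply: bmeasM => //; apply: bmeasB => //; exact: bmeas_cst.
  (* From F(y) phi(y) - F(x) phi(x) = phi(x) (F(y) - F(x)) + F(y) (phi(y) - phi(x)); each integrand
     then contains a factor of order y - x. *)
  have -> : W y - W x = itg (fun t => g t * (phi x - phi (cl t))) x y +
      itg (fun t => (F y - F t) * derive1 phi (cl t)) x y.
    rewrite /W (itg_chasles (bmeasD bgp bFp) ax xy) (itgD x y bgp bFp).
    have -> : itg (fun t => g t * (phi x - phi (cl t))) x y =
        phi x * itg g x y - itg (fun t => g t * phi (cl t)) x y.
      by rewrite -itgZ// -itgB ?bmeasZ//; [apply: eq_itg => t _; ring|exact: bmeasZ].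
    have -> : itg (fun t => (F y - F t) * derive1 phi (cl t)) x y =
        F y * itg (fun t => derive1 phi (cl t)) x y -
        itg (fun t => F t * derive1 phi (cl t)) x y.
      by rewrite -itgZ// -itgB//; [apply: eq_itg => t _; ring|exact: bmeasZ].
    by rewrite -FE// -phiE//; ring.
  rewrite (le_trans (ler_normD _ _))// (_ : 2 * (G * P) * _ =
    G * (P * (y - x)) * (y - x) + G * (y - x) * P * (y - x)); last by ring.
  have yx : 0 <= y - x by rewrite subr_ge0.
  rewrite lerD//; apply: itg_bound => // t /andP[xt ty]; rewrite normrM.
    rewrite ler_pM// clE ?(le_trans ax xt) ?(le_trans ty yb)// distrC phiE//.
      rewrite (le_trans (itg_bound bp' xt (fun s _ => pP s)))// ler_wpM2l// lerD2r//.
    exact: le_trans ty yb.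
  rewrite ler_pM// FE ?(le_trans ax xt)//.
  by rewrite (le_trans (itg_bound bg ty (fun s _ => gG s)))// ler_wpM2l// lerD2l lerN2.
have phia : phi a = 0 by apply: phi0; left.
have phib : phi b = 0 by apply: phi0; right.
move: Wba; rewrite /W phia phib !mulr0 itg_pt subrr sub0r => /eqP.
rewrite oppr_eq0 itgD// addrC addr_eq0 => /eqP.
rewrite -(itg_oo _ _ bFp) -(itg_oo _ _ bgp) => E.
transitivity (\int[mu]_(x in `]a, b[) (F x * derive1 phi (cl x))).
  apply: eq_Rintegral => x; rewrite inE/= in_itv/= => /andP[ax xb].
  by rewrite clE// !ltW.
rewrite E; congr (- _); apply: eq_Rintegral => x; rewrite inE/= in_itv/= => /andP[ax xb].
by rewrite clE// !ltW.
Qed.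

Lemma bmeas_L2on (D : set R) (f : R -> R) : measurable D -> (mu D < +oo)%E ->
  bmeas f -> L2on D f.
Proof.
move=> mD Doo bf; split; first by apply: measurable_funTS; case: bf.
have := bmeas_integrable mD Doo (bmeasM bf bf) => /integrableP[_].
apply: le_lt_trans; rewrite le_eqVlt; apply/orP; left; apply/eqP.
by apply: eq_integral => x _ /=; rewrite ger0_norm -expr2 ?sqr_ge0.
Qed.

(** Domination by 1 + f^2, integrable on a bounded interval. *)
Lemma L2on_L1on (a b : R) (f : R -> R) : L2on `[a, b] f -> L1on `[a, b] f.
Proof.
move=> [mf f2]; have mD : measurable (`[a, b]%classic : set R) by exact: measurable_itv.
have i2 : mu.-integrable `[a, b] (EFin \o (fun x => f x ^+ 2)).
  apply/integrableP; split; first exact/measurable_EFinP/measurable_funX.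
  apply: le_lt_trans f2; rewrite le_eqVlt; apply/orP; left; apply/eqP.
  by apply: eq_integral => x _ /=; rewrite ger0_norm ?sqr_ge0.
have i1 := bmeas_itv a b (bmeas_cst 1).
apply: (@le_integrable _ _ _ mu _ mD _ (EFin \o (fun x => 1 + f x ^+ 2))).
- exact/measurable_EFinP.
- move=> x _ /=; rewrite lee_fin [leRHS]ger0_norm ?addr_ge0 ?sqr_ge0//.
  rewrite -[f x ^+ 2]real_normK ?num_real//.
  by have := sqr_ge0 (`|f x| - 2^-1); nra.
- exact: (@integrableD _ _ _ mu _ mD _ _ i1 i2).
Qed.

End TimeIntegral.

(** * Passage to the limit *)

Lemma increasing_ge (sigma : nat -> nat) n :
  (forall n, (sigma n < sigma n.+1)%N) -> (n <= sigma n)%N.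
Proof. by move=> sS; elim: n => // n /leq_ltn_trans; apply. Qed.

Lemma cvg_increasing (sigma : nat -> nat) :
  (forall n, (sigma n < sigma n.+1)%N) -> sigma @ \oo --> \oo.
Proof.
move=> sS A [N _ NA]; exists N => // n /= Nn; apply: NA => /=.
exact: leq_trans Nn (increasing_ge n sS).
Qed.

(** * Choice of the subsequence *)

Section Subsequence.
Variables (R : realType) (V : finType) (h : nat -> R) (s b : nat -> nat -> V -> R) (M : R).
Hypotheses (h_gt0 : forall n, 0 < h n) (h_cvg0 : h @ \oo --> 0).
Hypotheses (s01 : forall n m, in01 (s n m)) (bM : forall n m i, `|b n m i| <= M).
Hypothesis sM : forall n m i, `|s n m.+1 i - s n m i| <= M * h n.

Let U n i t := s n (ceil_idx t (h n)) i.
Let f n i t := b n (ceil_idx t (h n)) i.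

Let M_ge0 (i : V) : 0 <= M := le_trans (normr_ge0 _) (bM 0 0 i).

Let bf n i : bmeas (f n i). Proof. exact: (bmeas_step (h_gt0 n) (fun m => bM n m i)). Qed.

(** Rounding both times up to the grid lengthens their distance by at most one step, hence the extra
    M h. *)
Lemma interpolant_lipschitz n i t1 t2 : 0 <= t1 -> 0 <= t2 ->
  `|U n i t1 - U n i t2| <= M * `|t1 - t2| + M * h n.
Proof.
have inc m k : `|s n (m + k) i - s n m i| <= M * (k%:R * h n).
  elim: k => [|k IH]; first by rewrite addn0 subrr normr0 mul0r mulr0.
  rewrite addnS -(subrKA (s n (m + k)%N i)) (le_trans (ler_normD _ _))//.
  by rewrite -natr1 mulrDl mul1r mulrDr addrC lerD.
wlog : t1 t2 / (ceil_idx t2 (h n) <= ceil_idx t1 (h n))%N => [H|le21] t10 t20.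
  have [?|/ltnW ?] := leqP (ceil_idx t2 (h n)) (ceil_idx t1 (h n)); first exact: H.
  by rewrite distrC [`|t1 - t2|]distrC; exact: H.
have /andP[a1 a2] := ceil_idx_bounds (h_gt0 n) t10.
have /andP[a3 a4] := ceil_idx_bounds (h_gt0 n) t20.
rewrite /U -(subnKC le21) (le_trans (inc _ _))// -mulrDr ler_wpM2l ?(M_ge0 i)//.
rewrite natrB// mulrBl; have := ler_norm (t1 - t2); lra.
Qed.

Lemma itg_lipschitz n i t1 t2 : 0 <= t1 -> 0 <= t2 ->
  `|itg (f n i) 0 t1 - itg (f n i) 0 t2| <= M * `|t1 - t2|.
Proof.
wlog : t1 t2 / t2 <= t1 => [H|le21] t10 t20.
  have [?|/ltW ?] := leP t2 t1; first exact: H.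
  by rewrite distrC [`|t1 - t2|]distrC; exact: H.
rewrite (itg_chasles (bf n i) t20 le21) addrAC subrr add0r.
rewrite [X in _ * X]ger0_norm ?subr_ge0//.
by apply: itg_bound => // x _; exact: bM.
Qed.

Lemma convergent_subsequence : exists sigma : nat -> nat,
  [/\ forall n, (sigma n < sigma n.+1)%N,
      forall i t, 0 <= t -> cvgn (fun n => U (sigma n) i t),
      forall i t, 0 <= t -> cvgn (fun n => itg (f (sigma n) i) 0 t) &
      forall i (T : nat), almost_gram (fun n => f (sigma n) i) T%:R].
Proof.
(* One countable index set for all requirements: the boolean selects values or primitives, and the
   numbers (p, j) encode the time j/(p+1). For the inner products p is reused as the horizon T. *)
pose K : Type := (bool * (V * (nat * nat)))%type.
pose q (k : K) : R := k.2.2.2%:R / k.2.2.1.+1%:R.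
pose x (k : K) n := if k.1 then U n k.2.1 (q k) else itg (f n k.2.1) 0 (q k).
pose a (k : K) m n := itg (fun t => f m k.2.1 t * f n k.2.1 t) 0 k.2.2.1%:R.
have q0 k : 0 <= q k by rewrite divr_ge0.
have xC k n : `|x k n| <= 1 + M * q k.
  have Mq : 0 <= M * q k by rewrite mulr_ge0// (M_ge0 k.2.1).
  rewrite /x; case: ifP => _.
    have /andP[? ?] := s01 n (ceil_idx (q k) (h n)) k.2.1.
    by rewrite ger0_norm// (le_trans (y:=1))// lerDl.
  rewrite (le_trans (itg_bound (bf _ _) (q0 k) (fun y _ => bM _ _ _)))// subr0.
  by rewrite lerDr.
have aD k m n : `|a k m n| <= M * M * k.2.2.1%:R.
  rewrite -[X in _ * X]subr0; apply: itg_bound => //; first exact: bmeasM.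
  by move=> y _; rewrite normrM ler_pM//; exact: bM.
have [sigma [y [z [sS H]]]] := diagonal_subsequence xC aD.
have xcvg k : cvgn (fun n => x k (sigma n)).
  apply/cvg_ex; exists (y k); apply/cvgrPdist_le => e e0.
  have /cvgrPdist_le/(_ e e0) := @geo_cvg0 R.
  move=> G; near=> n; have /H[+ _] : (pickle k <= n)%N by near: n; exact: nbhs_infty_ge.
  rewrite distrC => /le_trans; apply.
  have : `|0 - geo R n| <= e by near: n; exact: G.
  by rewrite sub0r normrN; apply: le_trans; exact: ler_norm.
have hs0 : (fun n => M * h (sigma n)) @ \oo --> 0.
  suff : (fun n => M * h (sigma n)) @ \oo --> M * 0 by rewrite mulr0.
  apply: cvgM; first exact: cvg_cst.
  exact: (cvg_comp sigma h (cvg_increasing sS) h_cvg0).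
exists sigma; split=> // i.
- apply: (grid_cvg (M_ge0 i) hs0) => [n t1 t2 *|p j]; first exact: interpolant_lipschitz.
  exact: (xcvg (true, (i, (p, j)))).
- apply: (@grid_cvg _ (fun n => itg (f (sigma n) i) 0) M (fun=> 0) (M_ge0 i)) => [|n t1 t2 *|p j].
  + exact: cvg_cst.
  + by rewrite addr0; exact: itg_lipschitz.
  + exact: (xcvg (false, (i, (p, j)))).
move=> T; pose k : K := (true, (i, (T, 0%N))).
pose B := M * M * T%:R + `|z k|.
have B0 : 0 <= B by rewrite addr_ge0// !mulr_ge0// (M_ge0 i).
have aB m n : `|a k m n - z k| <= B by rewrite (le_trans (ler_normB _ _))// lerD2r aD.
(* Before rank [pickle k] only the crude bound [B] is available; these finitely many terms
   contribute at most [pickle k] times [B], the geometric ones at most 2. *)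
exists (z k), (fun n => (if (n < pickle k)%N then B else 0) + geo R n),
  ((pickle k)%:R * B + 2), B; split.
- by move=> n; rewrite addr_ge0 ?(ltW (geo_gt0 _ _))//; case: ifP.
- move=> n; rewrite big_split/= lerD ?sum_geo//.
  elim: n (pickle k) => [|n IH] p; first by rewrite big_ord0 mulr_ge0.
  rewrite big_ord_recl/=; case: p => [|p].
    by rewrite ltnn add0r (le_trans _ (IH 0%N))// ler_sum.
  by rewrite ltnS leq0n -natr1 mulrDl mul1r addrC lerD// (le_trans _ (IH p)).
- move=> m n mn; case: ltnP => [mk|km].
    rewrite (le_trans (aB _ _))// -addrA lerDl.
    by rewrite !addr_ge0 ?(ltW (geo_gt0 _ _))//; case: ifP.
  have [_ /(_ m km mn)] := H k n (leq_trans km (ltnW mn)).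
  move=> /le_trans; apply; rewrite add0r lerD2l lerDr; case: ifP => //.
- by move=> m; exact: aB.
Unshelve. all: by end_near. Qed.

End Subsequence.

(** * Numerical Cesaro means of length 4^k, and two facts on integration *)

Section CesaroNumbers.
Variable R : realType.

Lemma cesaro_sub (v : nat -> R) (l : R) : v @ \oo --> l ->
  (fun k => (4 ^ k)%:R^-1 * \sum_(n < 4 ^ k) v n) @ \oo --> l.
Proof.
move=> /cesaro vl.
(* [arithmetic_mean v n] averages n + 1 terms, hence the index 4^k - 1. *)
have S k : ((4 ^ k).-1 < (4 ^ k.+1).-1)%N.
  have p4 : (0 < 4 ^ k)%N by rewrite expn_gt0.
  by rewrite expnS; lia.
have -> : (fun k => (4 ^ k)%:R^-1 * \sum_(n < 4 ^ k) v n) =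
    arithmetic_mean v \o (fun k => (4 ^ k).-1).
  apply/funext => k.
  by rewrite /arithmetic_mean /= /series/= prednK ?expn_gt0// big_mkord.
exact: cvg_comp (cvg_increasing S) vl.
Qed.

(** The averages of min(0, v) lie below those of [v] and tend to 0, because only finitely many terms
    are negative. *)
Lemma cesaro_sub_ge0 (v : nat -> R) (l : R) : (\forall n \near \oo, 0 <= v n) ->
  (fun k => (4 ^ k)%:R^-1 * \sum_(n < 4 ^ k) v n) @ \oo --> l -> 0 <= l.
Proof.
move=> v0 vl.
have m0 : (fun n => Num.min 0 (v n)) @ \oo --> 0.
  apply: cvg_near_cst; apply: filterS v0 => n vn.
  by apply/eqP; rewrite min_l.
have := cesaro_sub m0 => ml.
apply: (ler_cvg_to ml vl); apply: nearW => k.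
by rewrite ler_wpM2l ?invr_ge0//; apply: ler_sum => n _; rewrite ge_min lexx orbT.
Qed.

Lemma cesaro_sub_le0 (v : nat -> R) (l : R) : (\forall n \near \oo, v n <= 0) ->
  (fun k => (4 ^ k)%:R^-1 * \sum_(n < 4 ^ k) v n) @ \oo --> l -> l <= 0.
Proof.
move=> v0 /cvgN vl; rewrite -oppr_ge0; apply: (@cesaro_sub_ge0 (fun n => - v n)).
  by apply: filterS v0 => n; rewrite oppr_ge0.
rewrite [X in X @ _](_ : _ =
  (fun k => - ((4 ^ k)%:R^-1 * \sum_(n < 4 ^ k) v n)))//.
by apply/funext => k; rewrite sumrN mulrN.
Qed.

Lemma ae_neq0 : {ae (@lebesgue_measure R), forall t, t != 0}.
Proof.
exists [set 0]; split; [exact: measurable_set1|exact: lebesgue_measure_set1|].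
by move=> t /= /negP; rewrite negbK => /eqP.
Qed.

Lemma Rintegral_fsum (I : Type) (l : seq I) (D : set R) (f : I -> R -> R) :
  measurable D -> (forall i, (@lebesgue_measure R).-integrable D (EFin \o f i)) ->
  Rintegral (@lebesgue_measure R) D (fun x => \sum_(i <- l) f i x) =
  \sum_(i <- l) Rintegral (@lebesgue_measure R) D (f i).
Proof.
move=> mD fi.
suff [_ //] : (@lebesgue_measure R).-integrable D (EFin \o (fun x => \sum_(i <- l) f i x)) /\
  Rintegral (@lebesgue_measure R) D (fun x => \sum_(i <- l) f i x) =
  \sum_(i <- l) Rintegral (@lebesgue_measure R) D (f i).
elim: l => [|i l [IH1 IH2]].
  rewrite (_ : (fun x => \sum_(i <- [::]) f i x) = (fun=> 0)); last first.
    by apply/funext => x; rewrite big_nil.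
  by rewrite big_nil Rintegral_cst// mul0r; split => //; exact: integrable0.
rewrite (_ : (fun x => \sum_(i <- i :: l) f i x) = (fun x => f i x + \sum_(i <- l) f i x)).
  rewrite big_cons -IH2 RintegralD//; split => //.
  exact: (@integrableD _ _ _ (@lebesgue_measure R) _ mD _ _ (fi i) IH1).
by apply/funext => x; rewrite big_cons.
Qed.

End CesaroNumbers.

(** * The limit pair and its flow equation *)

Section Limit.
Variables (R : realType) (V : finType) (w : V -> V -> R) (r : R).
Notation mu := (@lebesgue_measure R).
Variables (eps : R) (u0 : V -> R) (h : nat -> R) (s b : nat -> nat -> V -> R) (M : R).
Hypothesis wG : weighted_graph w.
Hypotheses (eps0 : 0 < eps) (u01 : in01 u0).
Hypotheses (h_gt0 : forall n, 0 < h n) (h_cvg0 : h @ \oo --> 0).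
Hypotheses (s0 : forall n, s n 0%N = u0) (sB : forall n m, inB (s n m.+1) (b n m.+1)).
Hypothesis (bM : forall n m i, `|b n m i| <= M).
Hypothesis sM : forall n m i, `|s n m.+1 i - s n m i| <= M * h n.
Hypothesis scheme : forall n m i,
  `|s n m.+1 i - s n m i - h n * flow_rhs w r eps (s n m.+1) (b n m.+1) i| <= M * h n ^+ 2.

Let U n i t := s n (ceil_idx t (h n)) i.
Let f n i t := b n (ceil_idx t (h n)) i.

Hypothesis U_cvg : forall i t, 0 <= t -> cvgn (fun n => U n i t).
Hypothesis itg_cvgn : forall i t, 0 <= t -> cvgn (fun n => itg (f n i) 0 t).
Hypothesis gram : forall i (T : nat), almost_gram (fun n => f n i) T%:R.

Let s01 n m : in01 (s n m).
Proof. by case: m => [|m]; [rewrite s0|case: (sB n m)]. Qed.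

Let s1 n m i : `|s n m i| <= 1.
Proof. by have /andP[? ?] := s01 n m i; rewrite ger0_norm. Qed.

Let M_ge0 (i : V) : 0 <= M := le_trans (normr_ge0 _) (bM 0 0 i).

Let bf n i : bmeas (f n i). Proof. exact: (bmeas_step (h_gt0 n) (fun m => bM n m i)). Qed.
Let bU n i : bmeas (U n i). Proof. exact: (bmeas_step (h_gt0 n) (fun m => s1 n m i)). Qed.

(** Extended to negative times by the value at 0, so that the limit exists for every real t and
    measurability and continuity hold on the whole line. *)
Definition ulim (t : R) (i : V) : R := limn (fun n => U n i (Num.max 0 t)).

Lemma ulim_cvg i t : 0 <= t -> (fun n => U n i t) @ \oo --> ulim t i.
Proof. by move=> t0; rewrite /ulim max_r//; exact: U_cvg. Qed.

Lemma ulim_in01 t : in01 (ulim t).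
Proof.
move=> i; have m0 : 0 <= Num.max 0 t by rewrite le_max lexx.
have c := U_cvg (i := i) m0; apply/andP; split.
  by apply: (cvgr_to_ge c); apply: nearW => n; case/andP: (s01 n (ceil_idx (Num.max 0 t) (h n)) i).
by apply: (cvgr_to_le c); apply: nearW => n; case/andP: (s01 n (ceil_idx (Num.max 0 t) (h n)) i).
Qed.

Lemma bmeas_ulim i : bmeas (fun t => ulim t i).
Proof.
split; last first.
  by exists 1 => t; have /andP[? ?] := ulim_in01 t i; rewrite ger0_norm.
have mU n : measurable_fun setT (fun t : R => U n i (Num.max 0 t)).
  apply: (measurableT_comp (f := U n i)); first by case: (bU n i).
  by apply: measurable_maxr; [exact: measurable_cst|exact: measurable_id].
apply: (measurable_fun_cvg mU) => t _.
by apply: U_cvg; rewrite le_max lexx.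
Qed.

Lemma ulim0 : ulim 0 = u0.
Proof.
apply/funext => i; have := @ulim_cvg i 0 (lexx 0).
rewrite (_ : (fun n => U n i 0) = fun=> u0 i); last first.
  by apply/funext => n; rewrite /U ceil_idx_le0 s0.
by move=> H; rewrite (cvg_unique _ H (cvg_cst _)).
Qed.

Lemma glim_exists : exists g : R -> V -> R,
  [/\ forall i, measurable_fun setT (fun t => g t i), forall t i, `|g t i| <= M &
    {ae mu, forall t, 0 <= t -> forall i,
      (fun k => cmean (fun n => f n i) (4 ^ k) t) @ \oo --> g t i}].
Proof.
have /choice[g gP] : forall i, exists g : R -> R,
    [/\ measurable_fun setT g, forall x, `|g x| <= M &
    {ae mu, forall x, 0 <= x -> (fun k => cmean (fun n => f n i) (4 ^ k) x) @ \oo --> g x}].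
  move=> i; apply: (@cesaro_limit _ (fun n => f n i) M) => // n; first by case: (bf n i).
  by move=> x; exact: bM.
exists (fun t i => g i t); split=> [i|t i|]; [by case: (gP i)|by case: (gP i)|].
(* A countable intersection of sets of full measure, with the vertices numbered by [enum_rank]. *)
have H : {ae mu, forall t, forall j : nat, forall i, enum_rank i = j :> nat -> 0 <= t ->
    (fun k => cmean (fun n => f n i) (4 ^ k) t) @ \oo --> g i t}.
  apply: ae_foralln => j.
  have [[i ij]|nj] := pselect (exists i : V, enum_rank i = j :> nat).
    have [_ _] := gP i; apply: ae_imply => t H i' ij' t0.
    have -> : i' = i by apply: enum_rank_inj; apply: ord_inj; rewrite ij'.
    exact: H.
  by apply: aeW => t i ij; case: nj; exists i.
by apply: ae_imply H => t H t0 i; exact: H (enum_rank i) i erefl t0.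
Qed.

Section WithLimit.
Variable g : R -> V -> R.
Hypothesis mg : forall i, measurable_fun setT (fun t => g t i).
Hypothesis gM : forall t i, `|g t i| <= M.
Hypothesis fg : {ae mu, forall t, 0 <= t -> forall i,
      (fun k => cmean (fun n => f n i) (4 ^ k) t) @ \oo --> g t i}.

Let bg i : bmeas (fun t => g t i). Proof. by split => //; exists M => t; exact: gM. Qed.

(** The primitives converge by the choice of the subsequence; their Cesaro means keep that limit
    and, by dominated convergence, tend to the primitive of [g]. *)
Lemma itg_glim i t : 0 <= t -> (fun n => itg (f n i) 0 t) @ \oo --> itg (fun x => g x i) 0 t.
Proof.
move=> t0; have c := itg_cvgn (i := i) t0; have := cesaro_sub c => c1.
have c2 : (fun k => itg (cmean (fun n => f n i) (4 ^ k)) 0 t) @ \oo --> itg (fun x => g x i) 0 t.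
  apply: (@itg_cvg _ _ _ M) => //.
  - by move=> k; have [] := @bmeas_cmean _ (fun n => f n i) M (fun n => (bf n i).1)
      (fun n x => bM _ _ _) (4 ^ k).
  - by move=> k x; apply: cmean_bound => // n y; exact: bM.
  - by apply: ae_imply fg => x H /=; rewrite in_itv/= => /andP[x0 _]; exact: H.
have E : (fun k => itg (cmean (fun n => f n i) (4 ^ k)) 0 t) =
   (fun k => (4 ^ k)%:R^-1 * \sum_(n < 4 ^ k) itg (f n i) 0 t).
  apply/funext => k; rewrite /cmean itgZ; last by apply: bmeas_sum => n; exact: bf.
  by rewrite itg_sum// => n; exact: bf.
rewrite E in c2; by rewrite -(cvg_unique _ c1 c2).
Qed.

Let G i x := flow_rhs w r eps (ulim x) (g x) i.

Lemma bmeas_flow_rhs (v c : R -> V -> R) i :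
  (forall j, bmeas (fun x => v x j)) -> (forall j, bmeas (fun x => c x j)) ->
  bmeas (fun x => flow_rhs w r eps (v x) (c x) i).
Proof.
move=> bv bc; rewrite (_ : (fun x => _) = (fun x =>
    \sum_j flow_ucoef w r eps i j * v x j + \sum_j flow_bcoef w r eps i j * c x j)).
  by apply: bmeasD; apply: bmeas_sum => j; exact: bmeasZ.
by apply/funext => x; rewrite flow_rhsE.
Qed.

Lemma itg_flow_rhs (v c : R -> V -> R) i t1 t2 :
  (forall j, bmeas (fun x => v x j)) -> (forall j, bmeas (fun x => c x j)) ->
  itg (fun x => flow_rhs w r eps (v x) (c x) i) t1 t2 =
  \sum_j flow_ucoef w r eps i j * itg (fun x => v x j) t1 t2 +
  \sum_j flow_bcoef w r eps i j * itg (fun x => c x j) t1 t2.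
Proof.
move=> bv bc; rewrite (_ : (fun x => _) = (fun x =>
    \sum_j flow_ucoef w r eps i j * v x j + \sum_j flow_bcoef w r eps i j * c x j)).
  rewrite itgD; [|by apply: bmeas_sum => j; exact: bmeasZ..].
  rewrite !itg_sum; [|by move=> j; exact: bmeasZ..].
  by congr (_ + _); apply: eq_bigr => j _; rewrite itgZ.
by apply/funext => x; rewrite flow_rhsE.
Qed.

Lemma flow_rhs_bound n m i : `|flow_rhs w r eps (s n m) (b n m) i| <=
  \sum_j `|flow_ucoef w r eps i j| + \sum_j `|flow_bcoef w r eps i j| * M.
Proof.
rewrite flow_rhsE (le_trans (ler_normD _ _))// lerD// (le_trans (ler_norm_sum _ _ _))//.
  by apply: ler_sum => j _; rewrite normrM ler_piMr.
by apply: ler_sum => j _; rewrite normrM ler_wpM2l.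
Qed.

Let bG i : bmeas (G i). Proof. by apply: bmeas_flow_rhs => // j; exact: bmeas_ulim. Qed.

(** The scheme is summed up to time t with error O(h). By linearity the right-hand side converges as
    soon as [U] does pointwise and [f] does in its primitives. *)
Lemma ulim_integral i t : 0 <= t -> ulim t i = u0 i + itg (G i) 0 t.
Proof.
move=> t0; pose Fn n := itg (fun x => flow_rhs w r eps (U n ^~ x) (f n ^~ x) i) 0 t.
have FG : Fn @ \oo --> itg (G i) 0 t.
  rewrite itg_flow_rhs//; last by move=> j; exact: bmeas_ulim.
  rewrite (_ : Fn = fun n => \sum_j flow_ucoef w r eps i j * itg (U n j) 0 t +
      \sum_j flow_bcoef w r eps i j * itg (f n j) 0 t); last first.
    by apply/funext => n; rewrite /Fn itg_flow_rhs.
  apply: cvgD; apply: cvg_sumr => j; apply: cvgM; try exact: cvg_cst.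
    apply: (@itg_cvg _ _ _ 1) => [n|n x||]; [by case: (bU n j)|exact: s1|exact: bmeas_ulim|].
    by apply: aeW => x /=; rewrite in_itv/= => /andP[x0 _]; exact: ulim_cvg.
  exact: itg_glim.
set Kc := \sum_j `|flow_ucoef w r eps i j| + \sum_j `|flow_bcoef w r eps i j| * M.
have err n : `|U n i t - u0 i - Fn n| <= M * h n * (t + h n) + Kc * h n.
  rewrite -[u0](s0 n); apply: (@itg_step_approx R (h n) (fun m => s n m i)
      (fun m => flow_rhs w r eps (s n m) (b n m) i)) => //.
  - exact: M_ge0 i.
  - by move=> m; exact: flow_rhs_bound.
have lim0 : (fun n => M * h n * (t + h n) + Kc * h n) @ \oo --> M * 0 * (t + 0) + Kc * 0.
  apply: cvgD; apply: cvgM; try exact: cvg_cst; last by [].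
    by apply: cvgM; [exact: cvg_cst|].
  by apply: cvgD; [exact: cvg_cst|].
have lim1 : (fun n => `|U n i t - u0 i - Fn n|) @ \oo --> `|ulim t i - u0 i - itg (G i) 0 t|.
  apply: cvg_norm; apply: cvgB => //; apply: cvgB; [exact: ulim_cvg|exact: cvg_cst].
have : `|ulim t i - u0 i - itg (G i) 0 t| <= M * 0 * (t + 0) + Kc * 0.
  by apply: (ler_cvg_to lim1 lim0); exact: nearW.
rewrite !mulr0 mul0r addr0 normr_le0 => E.
by apply/eqP; rewrite -subr_eq0 opprD addrA.
Qed.

Lemma ulim_increment i t1 t2 : 0 <= t1 -> t1 <= t2 -> ulim t2 i - ulim t1 i = itg (G i) t1 t2.
Proof.
move=> t10 t12; rewrite !ulim_integral// ?(le_trans t10 t12)//.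
by rewrite (itg_chasles (bG i) t10 t12); ring.
Qed.

Lemma continuous_ulim i : continuous (fun t => ulim t i).
Proof.
have [_ [B GB]] := bG i.
have B0 : 0 <= B := le_trans (normr_ge0 _) (GB 0).
have lip0 t1 t2 : 0 <= t1 -> t1 <= t2 -> `|ulim t2 i - ulim t1 i| <= B * (t2 - t1).
  by move=> t10 t12; rewrite ulim_increment//; apply: itg_bound.
have ulim_max t : ulim t i = ulim (Num.max 0 t) i.
  by rewrite /ulim [Num.max 0 (Num.max 0 t)]max_r// le_max lexx.
have lip t1 t2 : `|ulim t1 i - ulim t2 i| <= B * `|t1 - t2|.
  wlog t12 : t1 t2 / t2 <= t1 => [H|].
    by have [|/ltW] := leP t2 t1; [|rewrite distrC [`|t1 - t2|]distrC]; exact: H.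
  rewrite ulim_max [ulim t2 i]ulim_max (le_trans (lip0 _ _ _ _))//.
  - by rewrite le_max lexx.
  - by rewrite ge_max le_max lexx/= le_max t12 orbT.
  rewrite ler_wpM2l// ger0_norm ?subr_ge0//.
  by have [] := leP 0 t1; have [] := leP 0 t2; lra.
move=> t; apply/cvgrPdist_le => e e0.
have d0 : 0 < e / (B + 1) by rewrite divr_gt0// ltr_wpDl.
near=> x; rewrite (le_trans (lip _ _))//.
have : `|t - x| <= e / (B + 1).
  by near: x; apply/nbhs_ballP; exists (e / (B + 1)) => // y; exact: ltW.
rewrite ler_pdivlMr ?ltr_wpDl// mulrC; apply: le_trans.
by rewrite ler_wpM2r// lerDl.
Unshelve. all: by end_near. Qed.

(** If the limit is below 1, then eventually U n < 1 and f n >= 0, which gives g >= 0; a limit above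
    0 gives g <= 0 in the same way, and strictly between both hold. For t > 0 the index is at least
    1, where [inB] is available. *)
Lemma obstacle_limit t : 0 < t ->
  (forall i, (fun k => cmean (fun n => f n i) (4 ^ k) t) @ \oo --> g t i) ->
  inB (ulim t) (g t).
Proof.
move=> t0 fgt; split; first exact: ulim_in01.
move=> i; have Uc := @ulim_cvg i t (ltW t0).
have sBt n : inB (U n ^~ t) (f n ^~ t).
  have := ceil_idx_gt0 (h_gt0 n) t0; rewrite /U /f.
  by case: (ceil_idx t (h n)) => // m _; exact: sB.
have ge0 : ulim t i < 1 -> 0 <= g t i.
  move=> u1; apply: (@cesaro_sub_ge0 _ (fun n => f n i t)); last exact: fgt.
  apply: (filterS _ (cvgr_lt _ Uc _ u1)) => n Un1.
  have [/(_ i)/andP[U0 _] /(_ i)[B0 [Bm _]]] := sBt n.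
  have [U00|Un0] := eqVneq (U n i t) 0; first exact: B0.
  by rewrite Bm// Un1 lt_neqAle eq_sym Un0 U0.
have le0 : 0 < ulim t i -> g t i <= 0.
  move=> u1; apply: (@cesaro_sub_le0 _ (fun n => f n i t)); last exact: fgt.
  apply: (filterS _ (cvgr_gt _ Uc _ u1)) => n Un1.
  have [/(_ i)/andP[_ U1] /(_ i)[_ [Bm B1]]] := sBt n.
  have [U11|Un0] := eqVneq (U n i t) 1; first exact: B1.
  by rewrite Bm// Un1 lt_neqAle Un0 U1.
split; first by move=> u_0; apply: ge0; rewrite u_0.
split; last by move=> u_1; apply: le0; rewrite u_1.
by move=> /andP[u_0 u_1]; apply/eqP; rewrite eq_le le0// ge0.
Qed.

Lemma limit_AC_solution : AC_solution w r eps ulim g.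
Proof.
split; [exists (fun t i => G i t); split|split].
- move=> t1 t2 t10 t12 i.
  have mtt : (mu `]t1, t2[ < +oo)%E.
    rewrite (le_lt_trans (y := mu `[t1, t2]))//; last by rewrite mu_itvcc ltry.
    by apply: le_measure; rewrite ?inE//; exact: subset_itv_oo_cc.
  split; first by apply: bmeas_L2on => //; exact: bmeas_ulim.
  split; first exact: bmeas_L2on.
  apply: weak_deriv_primitive => //; first exact: bmeas_ulim.
  by move=> x y ax xy _; apply: ulim_increment => //; exact: le_trans ax.
(* Time 0 is discarded as a null set; the equation is the definition of [G] multiplied by eps. *)
- apply: ae_imply (ae_and fg (ae_neq0 R)) => t [H tn0] /=; rewrite in_itv/= andbT => t0.
  split; last by apply: obstacle_limit => //; [rewrite lt_neqAle eq_sym tn0|exact: H].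
  by move=> i; rewrite /G /flow_rhs; field; rewrite gt_eqF.
- by move=> i; apply: continuous_subspaceT; exact: continuous_ulim.
- by move=> t _; exact: ulim_in01.
Qed.

(** On [0, T] the steps of [beta] and [b] can differ only at t = 0, which is removed by passing to
    the half-open interval; then weak convergence to 0 applies to f n - g in each coordinate. *)
Lemma weak_limit (beta : nat -> nat -> V -> R) (T : R) (phi : R -> V -> R) : 0 < T ->
  (forall n m, beta n m.+1 = b n m.+1) -> (forall i, L1on `[0, T] (fun t => phi t i)) ->
  (fun n => Rintegral mu `[0, T] (fun t => ipV w r (beta n (ceil_idx t (h n))) (phi t)))
    @ \oo --> Rintegral mu `[0, T] (fun t => ipV w r (g t) (phi t)).
Proof.
move=> T0 betaE iphi.
have mT : measurable (`[0, T]%classic : set R) by exact: measurable_itv.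
have ipE (c : R -> V -> R) : (forall i, bmeas (fun t => c t i)) ->
    Rintegral mu `[0, T] (fun t => ipV w r (c t) (phi t)) =
    \sum_i deg w i `^ r * Rintegral mu `[0, T] (fun t => c t i * phi t i).
  move=> bc; have ic i : mu.-integrable `[0, T] (EFin \o (fun t => c t i * phi t i)).
    by apply: bmeasM_integrable => //; exact: iphi.
  rewrite /ipV Rintegral_fsum//.
    by apply: eq_bigr => i _; rewrite RintegralZr// mulrC.
  move=> i; rewrite (_ : (fun t => _) = (fun t => deg w i `^ r * (c t i * phi t i))).
    by apply: bmeasM_integrable => //; exact: bmeas_cst.
  by apply/funext => t; rewrite mulrC.
have bbeta n i : bmeas (fun t => beta n (ceil_idx t (h n)) i).
  apply: (bmeas_step (h_gt0 n) (c := fun m => beta n m i) (K := M + `|beta n 0%N i|)).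
  move=> [|m]; first by rewrite lerDr (M_ge0 i).
  by rewrite betaE (le_trans (bM _ _ _))// lerDl.
have ocE (c : R -> R) i : bmeas c ->
    Rintegral mu `]0, T] (fun t => c t * phi t i) =
    Rintegral mu `[0, T] (fun t => c t * phi t i).
  move=> bc; apply: Rintegral_itv_obnd_cbnd.
  have := bmeasM_integrable mT bc (iphi i); apply: integrableS => //.
  exact: subset_itv_oc_cc.
have fE n i : Rintegral mu `[0, T] (fun t => beta n (ceil_idx t (h n)) i * phi t i) =
    Rintegral mu `[0, T] (fun t => f n i t * phi t i).
  rewrite -(ocE _ i (bbeta n i)) -(ocE _ i (bf n i)); apply: eq_Rintegral => t.
  rewrite inE/= in_itv/= => /andP[t0 _]; rewrite /f.
  by have := ceil_idx_gt0 (h_gt0 n) t0; case: (ceil_idx t (h n)) => // m _; rewrite betaE.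
rewrite ipE//.
rewrite (_ : (fun n => _) = (fun n =>
    \sum_i deg w i `^ r * Rintegral mu `[0, T] (fun t => f n i t * phi t i))); last first.
  by apply/funext => n; rewrite ipE//; apply: eq_bigr => i _; rewrite fE.
apply: cvg_sumr => i; apply: cvgM; first exact: cvg_cst.
have bfg n : bmeas (fun t => f n i t - g t i) by exact: bmeasB.
have d0 : (fun n => Rintegral mu `[0, T] (fun t => (f n i t - g t i) * phi t i)) @ \oo --> 0.
  apply: (@weak_cvg_integrable _ (fun n t => f n i t - g t i) (M + M)) => //.
  - by move=> n; case: (bfg n).
  - by move=> n t; rewrite (le_trans (ler_normB _ _))// lerD//; exact: bM.
  - move=> t /andP[t0 _].
    suff : (fun n => itg (fun x => f n i x - g x i) 0 t) @ \oo -->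
      itg (fun x => g x i) 0 t - itg (fun x => g x i) 0 t by rewrite subrr.
    rewrite (_ : (fun n => _) = (fun n => itg (f n i) 0 t - itg (fun x => g x i) 0 t)).
      by apply: cvgB; [exact: itg_glim|exact: cvg_cst].
    by apply/funext => n; rewrite itgB.
  - exact: iphi.
have E : (fun n => Rintegral mu `[0, T] (fun t => f n i t * phi t i)) = (fun n =>
    Rintegral mu `[0, T] (fun t => (f n i t - g t i) * phi t i) +
    Rintegral mu `[0, T] (fun t => g t i * phi t i)).
  apply/funext => n; rewrite -RintegralD//.
  - by apply: eq_Rintegral => t _; ring.
  - by apply: bmeasM_integrable => //; exact: iphi.
  - by apply: bmeasM_integrable => //; exact: iphi.
suff : (fun n => Rintegral mu `[0, T] (fun t => f n i t * phi t i)) @ \oo -->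
    0 + Rintegral mu `[0, T] (fun t => g t i * phi t i) by rewrite add0r.
by rewrite E; apply: cvgD => //; exact: cvg_cst.
Qed.

End WithLimit.
End Limit.

Theorem theorem43 (R : realType) (V : finType) (w : V -> V -> R) (r : R)
  (eps : R) (u0 : V -> R) (tau : nat -> R)
  (u beta : R -> nat -> V -> R) :
  weighted_graph w -> 0 <= r <= 1 ->
  0 < eps ->
  in01 u0 -> u0 <> (fun _ => 0) -> u0 <> (fun _ => 1) ->
  (forall n, 0 < tau n) -> (forall n, tau n.+1 <= tau n) -> tau @ \oo --> 0 ->
  (forall t, 0 < t < eps -> semi_discrete w r eps t u0 (u t) (beta t)) ->
  exists (sigma : nat -> nat) (uh gamma : R -> V -> R),
    (forall n, (sigma n < sigma n.+1)%N) /\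
    (forall n, tau (sigma n) < eps) /\
    AC_solution w r eps uh gamma /\ uh 0 = u0 /\
    (* (1) *)
    weak_L2loc w r
      (fun n t => beta (tau (sigma n)) (ceil_idx t (tau (sigma n)))) gamma /\
    weakstar_Linfloc w r
      (fun n t => beta (tau (sigma n)) (ceil_idx t (tau (sigma n)))) gamma /\
    (* (2) *)
    (forall t, 0 <= t -> forall i,
       (fun n => u (tau (sigma n)) (ceil_idx t (tau (sigma n))) i) @ \oo --> uh t i) /\
    (* (3) *)
    (exists N : nat -> nat,
       (forall M : nat, exists K : nat, forall k, (K <= k)%N -> (M <= N k)%N) /\
       {ae (@lebesgue_measure R), forall t, `[0, +oo[%classic t -> forall i,
          (fun k => (N k)%:R^-1 *
                    \sum_(n < N k) beta (tau (sigma n)) (ceil_idx t (tau (sigma n))) i)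
            @ \oo --> gamma t i}).
Proof.
move=> wG _ eps0 u01 un0 un1 tau0 _ tauc sd.
have [M [M0 est]] := discrete_estimates r wG eps0 u01 un0 un1.
(* The iterates are controlled for steps below eps, so the first [n0] terms are dropped before a
   subsequence is chosen. *)
have [n0 tau_lt] : exists n0, forall n, tau (n0 + n)%N < eps.
  have [n0 _ H] := cvgr_lt _ tauc _ eps0.
  by exists n0 => n; apply: H; rewrite /= leq_addr.
pose h n := tau (n0 + n)%N.
have h0 n : 0 < h n by exact: tau0.
have hc : h @ \oo --> 0.
  have -> : h = (fun n => tau (n + n0)%N) by apply/funext => n; rewrite /h addnC.
  by rewrite cvg_shiftn.
have hsd n : semi_discrete w r eps (h n) u0 (u (h n)) (beta (h n)).
  by apply: sd; rewrite h0 tau_lt.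
have hest n := est _ _ _ (introT andP (conj (h0 n) (tau_lt n))) (hsd n).
pose s n m := u (h n) m.
(* [beta (h n) 0] is unconstrained *)
pose b n m : V -> R := if m is m'.+1 then beta (h n) m else fun=> 0.
have sB n m : inB (s n m.+1) (b n m.+1) by have [_ /(_ m)[]] := hsd n.
have s0 n : s n 0%N = u0 by have [] := hsd n.
have s01 n m : in01 (s n m) by exact: (semi_discrete_in01 u01 m (hsd n)).
have bM n m i : `|b n m i| <= M.
  by case: m => [|m]; [rewrite normr0|have [] := hest n m i].
have sM n m i : `|s n m.+1 i - s n m i| <= M * h n by have [] := hest n m i.
have scheme n m i : `|s n m.+1 i - s n m i -
    h n * flow_rhs w r eps (s n m.+1) (b n m.+1) i| <= M * h n ^+ 2.
  by have [] := hest n m i.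
have [sig [sS Uc Ic gram]] := convergent_subsequence h0 hc s01 bM sM.
have hc' : (h \o sig) @ \oo --> 0 := cvg_comp sig h (cvg_increasing sS) hc.
have [g [mg gM fg]] := @glim_exists R V (h \o sig) (fun n => b (sig n)) M
  (fun n => h0 _) (fun n => bM _) gram.
have bg i : bmeas (fun t => g t i) by split=> //; exists M.
have bbeta n i : bmeas (fun t => beta (h n) (ceil_idx t (h n)) i).
  apply: (bmeas_step (h0 n) (c := fun m => beta (h n) m i)
    (K := M + `|beta (h n) 0%N i|)) => -[|m]; first by rewrite lerDr.
  by rewrite (le_trans (bM n m.+1 i))// lerDl.
have muT (T : R) : (lebesgue_measure `[0%R, T] < +oo)%E by rewrite mu_itvcc ltry.
have weak := @weak_limit R V w r (h \o sig) (fun n => b (sig n)) M (fun n => h0 _)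
  (fun n => bM _) Ic g mg gM fg (fun n => beta (h (sig n))).
exists (fun n => n0 + sig n)%N, (ulim (h \o sig) (fun n => s (sig n))), g.
split; first by move=> n; rewrite ltn_add2l.
split; first by move=> n; exact: tau_lt.
split; [|split; [|split; [|split; [|split]]]].
- apply: (@limit_AC_solution R V w r eps u0 (h \o sig) (fun n => s (sig n))
    (fun n => b (sig n)) M) => // n; exact: h0.
- by apply: (@ulim0 R V u0 (h \o sig) (fun n => s (sig n))) => // n; exact: h0.
- move=> T T0; split; [|split].
  + by move=> n i; apply: bmeas_L2on => //; exact: (bbeta (sig n) i).
  + by move=> i; apply: bmeas_L2on => //; exact: bg.
  + by move=> phi iphi; apply: weak => // i; apply: L2on_L1on; exact: iphi.
- move=> T T0; split; [|split].
  + move=> n i; have [mb [K bK]] := bbeta (sig n) i; split; first exact: measurable_funTS.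
    by exists K; apply: aeW => t _; exact: bK.
  + move=> i; split; first exact: measurable_funTS.
    by exists M; apply: aeW => t _; exact: gM.
  + by move=> phi iphi; apply: weak.
- move=> t t0 i; exact: (@ulim_cvg R V (h \o sig) (fun n => s (sig n)) Uc).
exists (fun k => 4 ^ k)%N; split.
  by move=> K; exists K => k Kk; rewrite (leq_trans Kk)// ltnW// ltn_expl.
(* At t = 0 the averages involve the arbitrary value of [beta] at index 0, so this point is left
   out. *)
apply: ae_imply (ae_and fg (ae_neq0 R)) => t [H tn0] /=; rewrite in_itv/= andbT => t0 i.
have := H t0 i; rewrite /cmean.
have tpos : 0 < t by rewrite lt_neqAle eq_sym tn0.
have bE n : b (sig n) (ceil_idx t (h (sig n))) i =
    beta (h (sig n)) (ceil_idx t (h (sig n))) i.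
  by have := ceil_idx_gt0 (h0 (sig n)) tpos; case: (ceil_idx t (h (sig n))).
by under eq_fun do under eq_bigr do rewrite bE.
Qed.
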